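(* Let $A$ be a C*-algebra, let $\mathsf{X}$ be any right Hilbert $A$-module, and let $(\rho_A, \pi_{\mathsf{X}})$ be a representation of $\mathsf{X}$ on a pair of Hilbert spaces $(\mathcal{H}_0, \mathcal{H}_1)$, with $\rho_A$ faithful. Suppose that $\pi_{\mathsf{X}}(\mathsf{X})\mathcal{H}_0$ is dense in $\mathcal{H}_1$. Then the C*-algebras $\mathcal{K}_A(\mathsf{X})$ and $\mathcal{L}_A(\mathsf{X})$ can be represented on $\mathcal{H}_1$ via the maps described below. (1) There is a $*$-isomorphism from $\mathcal{K}_A(\mathsf{X})$ to $$\overline{\mathrm{span} \{ \pi_{\mathsf{X}}(x)\pi_{\mathsf{X}}(y)^* \colon x,y \in \mathsf{X} \}} \subseteq \mathcal{L}(\mathcal{H}_1),$$ which sends $\theta_{x,y}$ to $\pi_{\mathsf{X}}(x)\pi_{\mathsf{X}}(y)^*$ for $x,y \in \mathsf{X}$. (2) Define $$B=\{ b \in \mathcal{L}(\mathcal{H}_1) \colon b\pi_{\mathsf{X}}(x), b^*\pi_{\mathsf{X}}(x) \in \pi_{\mathsf{X}}(\mathsf{X}) \mbox{ for all } x \in \mathsf{X} \}.$$ For each $b \in B$ we get a map $\tau(b) \colon \pi_{\mathsf{X}}(\mathsf{X}) \to \pi_{\mathsf{X}}(\mathsf{X})$, which sends $\pi_{\mathsf{X}}(x)$ to $\tau(b)(\pi_{\mathsf{X}}(x))=b\pi_{\mathsf{X}}(x)$. Then $B$ is $*$-isomorphic to $\mathcal{L}_A(\mathsf{X})$, via the map that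 sends $b \in B$ to $\pi_{\mathsf{X}}^{-1} \circ \tau(b)\circ \pi_{\mathsf{X}}$, where $\pi_{\mathsf{X}}^{-1}$ is interpreted as the inverse of the linear bijection $\pi_{\mathsf{X}} \colon \mathsf{X} \to \pi_{\mathsf{X}}(\mathsf{X})$.
   Context: $\mathcal{L}(\mathcal{H}_0,\mathcal{H}_1)$ is the space of bounded linear maps, and $\mathcal{L}(\mathcal{H})=\mathcal{L}(\mathcal{H},\mathcal{H})$. A representation of a C*-algebra on $\mathcal{H}$ is a $*$-homomorphism into $\mathcal{L}(\mathcal{H})$. The inner product $\langle-,-\rangle_A$ of a right Hilbert $A$-module is linear in the second variable and conjugate linear in the first. A representation of a right Hilbert $A$-module $\mathsf{X}$ on a pair of Hilbert spaces $(\mathcal{H}_0,\mathcal{H}_1)$ is a pair $(\rho_A,\pi_{\mathsf{X}})$ where $\rho_A$ is a representation of $A$ on $\mathcal{H}_0$ and $\pi_{\mathsf{X}}\colon\mathsf{X}\to\mathcal{L}(\mathcal{H}_0,\mathcal{H}_1)$ is a linear map such that for all $a\in A$ and $x,y\in\mathsf{X}$: $\pi_{\mathsf{X}}(xa)=\pi_{\mathsf{X}}(x)\rho_A(a)$ and $\rho_A(\langle x,y\rangle_A)=\pi_{\mathsf{X}}(x)^*\pi_{\mathsf{X}}(y)$. When $\rho_A$ is faithful, $\pi_{\mathsf{X}}$ is isometric, hence injective. $\pi_{\mathsf{X}}(\mathsf{X})\mathcal{H}_0=\mathrm{span}\{\pi_{\mathsf{X}}(x)\xi\colon x\in\mathsf{X},\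 \xi\in\mathcal{H}_0\}$. $\mathcal{L}_A(\mathsf{X})$ denotes the C*-algebra of adjointable maps $\mathsf{X}\to\mathsf{X}$; for $x,y\in\mathsf{X}$, $\theta_{x,y}\in\mathcal{L}_A(\mathsf{X})$ is given by $\theta_{x,y}(z)=x\langle y,z\rangle_A$; and $\mathcal{K}_A(\mathsf{X})=\overline{\mathrm{span}\{\theta_{x,y}\colon x,y\in\mathsf{X}\}}$. *)

(* Defs.v *)
From HB Require Import structures.
From mathcomp Require Import all_boot all_order all_algebra.
From mathcomp Require Import complex ring lra.
From mathcomp Require Import all_classical all_reals all_analysis.

Set Implicit Arguments.
Unset Strict Implicit.
Unset Printing Implicit Defensive.

Import Order.TTheory GRing.Theory Num.Theory.
Import numFieldNormedType.Exports.

Local Open Scope classical_set_scope.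
Local Open Scope ring_scope.

(* A complex star-algebra, not assumed to have a unit. *)
HB.mixin Record isStarAlgebra (R : realType) A & GRing.Lmodule R[i] A := {
  smul : A -> A -> A;
  star : A -> A;
  smulA : forall a b c, smul a (smul b c) = smul (smul a b) c;
  smulDl : forall a b c, smul (a + b) c = smul a c + smul b c;
  smulDr : forall a b c, smul a (b + c) = smul a b + smul a c;
  smulZl : forall k a b, smul (k *: a) b = k *: smul a b;
  smulZr : forall k a b, smul a (k *: b) = k *: smul a b;
  starK : forall a, star (star a) = a;
  starD : forall a b, star (a + b) = star a + star b;
  starZ : forall k a, star (k *: a) = k^* *: star a;
  starM : forall a b, star (smul a b) = smul (star b) (star a)
}.

#[short(type="starAlgType")]
HB.structure Definition StarAlgebra (R : realType) :=
  {A of GRing.Lmodule R[i] A & isStarAlgebra R A}.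

HB.mixin Record isCStarAlgebra (R : realType) A
    & CompleteNormedModule R[i] A & StarAlgebra R A := {
  ler_norm_smul : forall a b : A, `|smul a b| <= `|a| * `|b|;
  cstar_norm : forall a : A, `|smul (star a) a| = `|a| ^+ 2
}.

#[short(type="cstarAlgType")]
HB.structure Definition CStarAlgebra (R : realType) :=
  {A of CompleteNormedModule R[i] A & StarAlgebra R A & isCStarAlgebra R A}.

(* Inner products are linear in the second variable. *)
HB.mixin Record isHilbertSpace (R : realType) H & CompleteNormedModule R[i] H := {
  hdot : H -> H -> R[i];
  hdotDr : forall x y z, hdot x (y + z) = hdot x y + hdot x z;
  hdotZr : forall x k y, hdot x (k *: y) = k * hdot x y;
  hdotC : forall x y, (hdot x y)^* = hdot y x;
  hdot_norm : forall x : H, hdot x x = `|x| ^+ 2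
}.

#[short(type="hilbertType")]
HB.structure Definition HilbertSpace (R : realType) :=
  {H of CompleteNormedModule R[i] H & isHilbertSpace R H}.

(* An element of a C*-algebra is positive when it has the form [b^* b]. By
   [minner_norm] the norm of the ambient Banach space is [|<x, x>|^(1/2)]. *)
HB.mixin Record isHilbertModule (R : realType) (A : cstarAlgType R) X
    & CompleteNormedModule R[i] X := {
  mact : X -> A -> X;
  minner : X -> X -> A;
  mactDl : forall x y a, mact (x + y) a = mact x a + mact y a;
  mactDr : forall x a b, mact x (a + b) = mact x a + mact x b;
  mactZl : forall k x a, mact (k *: x) a = k *: mact x a;
  mactZr : forall k x a, mact x (k *: a) = k *: mact x a;
  mactM : forall x a b, mact x (smul a b) = mact (mact x a) b;
  minnerDr : forall x y z, minner x (y + z) = minner x y + minner x z;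
  minnerZr : forall x k y, minner x (k *: y) = k *: minner x y;
  minnerMr : forall x y a, minner x (mact y a) = smul (minner x y) a;
  minnerC : forall x y, star (minner x y) = minner y x;
  minner_ge0 : forall x, exists b, minner x x = smul (star b) b;
  minner_norm : forall x : X, `|minner x x| = `|x| ^+ 2
}.

#[short(type="hilbertModType")]
HB.structure Definition HilbertModule (R : realType) (A : cstarAlgType R) :=
  {X of CompleteNormedModule R[i] X & isHilbertModule R A X}.
Local Open Scope complex_scope.

Lemma ge0_ReE (R : realType) (z : R[i]) : 0 <= z -> z = (complex.Re z)%:C.
Proof. by case: z => a b; rewrite lecE /= => /andP[/eqP -> _]. Qed.

Lemma Re_normc_ge0 (R : realType) (z : R[i]) : 0 <= complex.Re `|z|.
Proof. by rewrite normc_def sqrtr_ge0. Qed.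

(* The norm of a [normedModType R[i]] takes its values in [R[i]]; [rnorm] is
   the same norm with values in [R]. *)
Section RealNorm.
Variables (R : realType) (V : normedModType R[i]).

Definition rnorm (x : V) : R := complex.Re `|x|.

Lemma rnormE x : `|x| = (rnorm x)%:C.
Proof. exact/ge0_ReE/normr_ge0. Qed.

Lemma rnorm_ge0 x : 0 <= rnorm x.
Proof. by rewrite -ler0c -rnormE. Qed.

Lemma rnormD x y : rnorm (x + y) <= rnorm x + rnorm y.
Proof. by rewrite -lecR rmorphD /= -!rnormE ler_normD. Qed.

Lemma rnormZ k x : rnorm (k *: x) = complex.Re `|k| * rnorm x.
Proof.
apply: complexI; rewrite rmorphM /= -!rnormE normrZ; congr (_ * _).
Qed.

Lemma rnormN x : rnorm (- x) = rnorm x.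
Proof. by rewrite /rnorm normrN. Qed.

Lemma rnormB x y : rnorm (x - y) = rnorm (y - x).
Proof. by rewrite -rnormN opprB. Qed.

Lemma rnorm0 : rnorm 0 = 0.
Proof. by rewrite /rnorm normr0. Qed.

Lemma rnorm0_eq0 x : rnorm x = 0 -> x = 0.
Proof. by move=> x0; apply/eqP; rewrite -normr_eq0 rnormE x0. Qed.

Lemma rnormZR (t : R) x : rnorm (t%:C *: x) = `|t| * rnorm x.
Proof. by rewrite rnormZ normc_def /= expr0n /= addr0 sqrtr_sqr. Qed.

Lemma rnormZi x : rnorm ('i%C *: x) = rnorm x.
Proof. by rewrite rnormZ normc_def /= expr0n expr1n /= add0r sqrtr1 mul1r. Qed.

End RealNorm.

Lemma rnorm_complete (R : realType) (V : completeNormedModType R[i])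
    (u : nat -> V) :
  (forall e : R, 0 < e ->
     exists N, forall m n, (N <= m)%N -> (N <= n)%N -> rnorm (u m - u n) < e) ->
  exists z, forall e : R, 0 < e ->
     exists N, forall n, (N <= n)%N -> rnorm (z - u n) < e.
Proof.
move=> uC.
have realpos (e : R[i]) : 0 < e -> e = (complex.Re e)%:C /\ 0 < complex.Re e.
  move=> e0; have eE := ge0_ReE (ltW e0).
  by split=> //; rewrite -ltcR -eE.
have /cauchy_cvgP/cvg_ex[z uz] : cauchy (u @ \oo).
  apply/cauchy_ballP => e /realpos[-> {}/uC[N uN]].
  exists (u @` [set n | (N <= n)%N], u @` [set n | (N <= n)%N]) => /=.
    by split; exists N => // n /= Nn; exists n.
  move=> [_ _] /= [[m Nm <-] [n Nn <-]].
  by rewrite -ball_normE /ball_ /= rnormE ltcR uN.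
exists z => e e0.
have : \forall n \near \oo, `|z - u n| < e%:C.
  by move/cvgrPdist_lt: uz; apply; rewrite ltcR.
by case=> N _ uN; exists N => n /uN /=; rewrite rnormE ltcR.
Qed.

Lemma sesqui_bound (R : realType) (V W : normedModType R[i]) (b : V -> V -> W) :
  (forall x y z, b x (y + z) = b x y + b x z) ->
  (forall x y z, b (x + y) z = b x z + b y z) ->
  (forall x k y, b x (k *: y) = k *: b x y) ->
  (forall k x y, b (k *: x) y = (k^*)%R *: b x y) ->
  (forall x, `|b x x| = `|x| ^+ 2) ->
  forall x y, rnorm (b x y) <= 4 * rnorm x * rnorm y.
Proof.
move=> bDr bDl bZr bZl bn.
have bN x y : b x (- y) = - b x y by rewrite -scaleN1r bZr scaleN1r.
have bNl x y : b (- x) y = - b x y.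
  by rewrite -scaleN1r bZl rmorphN /= rmorph1 scaleN1r.
have b2 x : rnorm (b x x) = rnorm x ^+ 2.
  by apply: complexI; rewrite -rnormE bn rnormE rmorphXn.
have sq (s t : R) : 0 <= s -> s <= t -> s ^+ 2 <= t ^+ 2.
  by move=> s0 st; rewrite ler_sqr ?nnegrE // (le_trans s0).
have sym x y : rnorm (b x y + b y x) <= (rnorm x + rnorm y) ^+ 2.
  have E : 2%:R%:C *: (b x y + b y x) = b (x + y) (x + y) - b (x - y) (x - y).
    rewrite !bDr !bDl !bN !bNl rmorph_nat scaler_nat mulr2n opprK.
    move: (b x x) (b y y) (b x y) (b y x) => a c p q.
    rewrite opprD opprB opprD opprK [RHS]addrACA [a + q]addrC.
    rewrite (addrACA q a q) (addrACA p c p) !subrr !addr0.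
    by rewrite [LHS]addrACA addrC.
  have := congr1 (@rnorm R W) E; rewrite rnormZR normr_nat => {}E.
  have : 2 * rnorm (b x y + b y x) <=
     (rnorm x + rnorm y) ^+ 2 + (rnorm x + rnorm y) ^+ 2; last by lra.
  rewrite E (le_trans (rnormD _ _)) // rnormN !b2 lerD //; apply: sq;
    rewrite ?rnorm_ge0 // (le_trans (rnormD _ _)) ?rnormN //.
have bd x y : rnorm (b x y) <= (rnorm x + rnorm y) ^+ 2.
  have E : 2%:R%:C *: b x y =
      (b x y + b y x) - 'i%C *: (b x ('i%C *: y) + b ('i%C *: y) x).
    have ii : 'i%C * ('i%C)^*%R = 1 :> R[i] by rewrite -normCK normc_def /=
      expr0n expr1n /= add0r sqrtr1 expr1n.
    have i2 : 'i%C * 'i%C = -1 :> R[i] by rewrite -expr2 sqr_i.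
    rewrite bZr bZl scalerDr !scalerA ii i2 scaleN1r scale1r opprD opprK.
    by rewrite addrACA subrr addr0 rmorph_nat scaler_nat mulr2n.
  have := congr1 (@rnorm R W) E; rewrite rnormZR normr_nat => {}E.
  have : 2 * rnorm (b x y) <=
     (rnorm x + rnorm y) ^+ 2 + (rnorm x + rnorm y) ^+ 2; last by lra.
  rewrite E (le_trans (rnormD _ _)) // rnormN rnormZi lerD ?sym //.
  by rewrite (le_trans (sym _ _)) // rnormZi.
move=> x y.
have [/eqP/rnorm0_eq0 ->|x0] := boolP (rnorm x == 0).
  by rewrite rnorm0 mulr0 mul0r -(scale0r (0 : V)) bZl rmorph0 scale0r rnorm0.
have [/eqP/rnorm0_eq0 ->|y0] := boolP (rnorm y == 0).
  by rewrite rnorm0 mulr0 -(scale0r (0 : V)) bZr scale0r rnorm0.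
have px : 0 < rnorm x by rewrite lt_def x0 rnorm_ge0.
have py : 0 < rnorm y by rewrite lt_def y0 rnorm_ge0.
have := bd ((rnorm x)^-1%:C *: x) ((rnorm y)^-1%:C *: y).
rewrite bZr bZl conj_Creal ?rnormZR; last by rewrite complex_real.
rewrite !ger0_norm ?invr_ge0 ?rnorm_ge0 // !mulVf // mulrCA -mulrA.
rewrite ler_pdivrMl // ler_pdivrMl // => /le_trans; apply.
by rewrite le_eqVlt; apply/orP; left; apply/eqP; ring.
Qed.

(* Uniform boundedness principle, for seminorms on a complex Banach space. *)
Lemma ubp (R : realType) (V : completeNormedModType R[i]) (I : Type)
    (p : I -> V -> R) :
  (forall i x y, p i (x + y) <= p i x + p i y) ->
  (forall i x, p i (- x) = p i x) ->
  (forall i (t : R) x, p i (t%:C *: x) = `|t| * p i x) ->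
  (forall i, exists M, forall x, p i x <= M * rnorm x) ->
  (forall x, exists M, forall i, p i x <= M) ->
  exists2 M, 0 <= M & forall i x, p i x <= M * rnorm x.
Proof.
move=> pD pN pZ pM pB.
have pB' i x y : p i x <= p i y + p i (x - y) by have := pD i y (x - y); rewrite subrKC.
have [[x0 [r [n [r0 H]]]]|H] := pselect (exists (x0 : V) (r : R) (n : nat),
    0 < r /\ forall i x, rnorm (x - x0) <= r -> p i x <= n%:R).
  exists (2 * n%:R / r) => [|i x]; first by rewrite divr_ge0 ?mulr_ge0 // ltW.
  have [/eqP/rnorm0_eq0 ->|xn0] := boolP (rnorm x == 0).
    by rewrite rnorm0 mulr0 -(scale0r (0 : V)) pZ normr0 mul0r.
  have px : 0 < rnorm x by rewrite lt_def xn0 rnorm_ge0.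
  have := pB' i ((r / rnorm x)%:C *: x) (- x0).
  rewrite pN opprK pZ ger0_norm ?divr_ge0 ?rnorm_ge0 ?(ltW r0) // => E.
  have h1 : p i x0 <= n%:R by apply: H; rewrite subrr rnorm0 ltW.
  have h2 : p i ((r / rnorm x)%:C *: x + x0) <= n%:R.
    apply: H; rewrite addrK rnormZR ger0_norm ?divr_ge0 ?rnorm_ge0 ?(ltW r0) //.
    by rewrite divfK.
  have {E h1 h2} : r / rnorm x * p i x <= 2 * n%:R by lra.
  rewrite mulrAC ler_pdivrMr // -ler_pdivlMl // => /le_trans; apply.
  by rewrite le_eqVlt; apply/orP; left; apply/eqP; ring.
have step (n : nat) (s : V * R) : {s' : V * R | 0 < s.2 ->
   [/\ 0 < s'.2, s'.2 <= n.+1%:R^-1, rnorm (s'.1 - s.1) + s'.2 <= s.2 &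
   exists i, forall y, rnorm (y - s'.1) <= s'.2 -> n%:R < p i y]}.
  apply: cid; have [s0|s0] := pselect (0 < s.2); last by exists s.
  have [i [x [xs px]]] : exists i x, rnorm (x - s.1) <= s.2 / 2 /\ n.+1%:R < p i x.
    apply: contrapT => N; apply: H; exists s.1, (s.2 / 2), n.+1; split.
      by rewrite divr_gt0.
    move=> i x xs; rewrite leNgt; apply/negP => px; apply: N.
    by exists i, x.
  have [M pMi] := pM i.
  pose K := `|M| + 1.
  have K0 : 0 < K by rewrite ltr_pwDr.
  pose r := Num.min (s.2 / 2) (Num.min n.+1%:R^-1 K^-1).
  have r0 : 0 < r by rewrite !lt_min divr_gt0 // !invr_gt0 ltr0Sn K0.
  have r1 : r <= s.2 / 2 by rewrite !ge_min lexx.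
  have r2 : r <= n.+1%:R^-1 by rewrite !ge_min lexx !orbT.
  have r3 : r <= K^-1 by rewrite !ge_min lexx !orbT.
  exists (x, r) => _; split => //=; first by lra.
  exists i => y yx; have := pB' i x y; rewrite -natr1 in px => E.
  have : p i (x - y) <= 1.
    rewrite (le_trans (pMi _)) // rnormB (le_trans (ler_norm _)) // normrM.
    rewrite (ger0_norm (rnorm_ge0 _)).
    have : K * rnorm (y - x) <= 1.
      by rewrite -ler_pdivlMl // mulr1 (le_trans yx).
    rewrite /K; have := rnorm_ge0 (y - x); lra.
  lra.
have [s [s_0 sS]] : exists s : nat -> V * R,
    s 0 = (0, 1) /\ forall n, s n.+1 = sval (step n (s n)).
  by exists (fix s n := if n is m.+1 then sval (step m (s m)) else (0, 1)).
have s0 n : 0 < (s n).2.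
  elim: n => [|n IH]; first by rewrite s_0.
  by rewrite sS; have [] := svalP (step n (s n)) IH.
have sn n := svalP (step n (s n)) (s0 n).
have {}sn n : [/\ (s n.+1).2 <= n.+1%:R^-1,
    rnorm ((s n.+1).1 - (s n).1) + (s n.+1).2 <= (s n).2 &
    exists i, forall y, rnorm (y - (s n.+1).1) <= (s n.+1).2 -> n%:R < p i y].
  by have [] := sn n; rewrite -sS.
have mono m k : rnorm ((s (k + m)%N).1 - (s m).1) + (s (k + m)%N).2 <= (s m).2.
  elim: k => [|k IH]; first by rewrite subrr rnorm0 add0r.
  have [_ + _] := sn (k + m)%N; rewrite -addSn => h.
  have := rnormD ((s (k.+1 + m)%N).1 - (s (k + m)%N).1) ((s (k + m)%N).1 - (s m).1).
  by rewrite subrKA; lra.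
have small n : (s n.+1).2 <= n.+1%:R^-1 by have [] := sn n.
have dist m n : (m <= n)%N -> rnorm ((s n).1 - (s m).1) < (s m).2.
  by move=> mn; have := mono m (n - m)%N; rewrite subnK // ; have := s0 n; lra.
have eps (e : R) : 0 < e -> exists N, forall n, (N <= n)%N -> n.+1%:R^-1 < e.
  move=> e0; exists (Num.truncn e^-1) => n Nn.
  rewrite invf_plt ?posrE ?ltr0Sn //.
  rewrite (lt_le_trans (truncnS_gt _)) // ler_nat ltnS //.
have [|z zP] := @rnorm_complete R V (fun n => (s n).1).
  move=> e e0; have [N NP] := eps (e / 2) (divr_gt0 e0 (ltr0Sn _ _)).
  exists N.+1 => m n Nm Nn.
  have := NP N (leqnn N).
  have := rnormD ((s m).1 - (s N.+1).1) ((s N.+1).1 - (s n).1).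
  rewrite subrKA (rnormB (s N.+1).1).
  have := dist _ _ Nm; have := dist _ _ Nn; have := small N.
  move: (N.+1%:R^-1) => t; lra.
have zs n : rnorm (z - (s n).1) <= (s n).2.
  apply/ler_addgt0Pl => e /zP[N NP].
  have := NP _ (leq_maxl N n); have := dist _ _ (leq_maxr N n).
  have := rnormD (z - (s (maxn N n)).1) ((s (maxn N n)).1 - (s n).1).
  rewrite subrKA; lra.
have [M MP] := pB z.
have [_ _ [i /(_ z (zs _.+1)) iP]] := sn (Num.truncn M).+1.
have := MP i; have := truncnS_gt M.
by move=> h1 h2; have := lt_trans h1 (lt_le_trans iP h2); rewrite ltxx.
Qed.

Section BoundedOp.
Variables (R : realType) (V W : normedModType R[i]).

Definition bounded_linear : {pred V -> W} := fun f =>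
  `[< linear f /\ exists M : R, forall x, `|f x| <= M%:C * `|x| >].

Lemma bounded_linearP (f : V -> W) : reflect
  (linear f /\ exists2 M, 0 <= M & forall x, rnorm (f x) <= M * rnorm x)
  (f \in bounded_linear).
Proof.
apply: (iffP (asboolP _)) => [[lf [M fM]]|[lf [M M0 fM]]]; split => //.
  exists `|M| => // x; rewrite (@le_trans _ _ (M * rnorm x)) //.
    by rewrite -lecR rmorphM /= -!rnormE.
  by rewrite ler_wpM2r ?rnorm_ge0 ?ler_norm.
by exists M => x; rewrite !rnormE -rmorphM lecR.
Qed.

Lemma bounded_linear_closed : submod_closed bounded_linear.
Proof.
split=> [|k f g /bounded_linearP[lf [M M0 fM]] /bounded_linearP[lg [N N0 gN]]].
  apply/bounded_linearP; split=> [a x y|]; first by rewrite /= scaler0 addr0.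
  by exists 0 => // x; rewrite rnorm0 mul0r.
apply/bounded_linearP; split=> [a x y|].
  change (k *: f (a *: x + y) + g (a *: x + y) =
    a *: (k *: f x + g x) + (k *: f y + g y)).
  rewrite lf lg !scalerDr !scalerA (mulrC a k).
  by rewrite addrACA.
exists (complex.Re `|k| * M + N) => [|x].
  by rewrite addr_ge0 ?mulr_ge0 ?Re_normc_ge0.
change (rnorm (k *: f x + g x) <= (complex.Re `|k| * M + N) * rnorm x).
rewrite (le_trans (rnormD _ _)) // mulrDl.
by rewrite lerD // rnormZ -mulrA ler_wpM2l ?Re_normc_ge0.
Qed.

HB.instance Definition _ :=
  GRing.isSubmodClosed.Build R[i] (V -> W) bounded_linear bounded_linear_closed.

Record bounded_op :=
  BoundedOp {bounded_op_fun :> V -> W; _ : bounded_op_fun \in bounded_linear}.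

HB.instance Definition _ := [isSub for bounded_op_fun].
HB.instance Definition _ := [Choice of bounded_op by <:].
HB.instance Definition _ := [SubChoice_isSubLmodule of bounded_op by <:].

Lemma bounded_op_linear (T : bounded_op) : linear T.
Proof. by case: T => f /= /bounded_linearP[]. Qed.

HB.instance Definition _ (T : bounded_op) :=
  GRing.isLinear.Build R[i] V W *:%R T (@bounded_op_linear T).

Lemma bounded_opP (T : bounded_op) :
  exists2 M, 0 <= M & forall x, rnorm (T x) <= M * rnorm x.
Proof. by case: T => f /= /bounded_linearP[]. Qed.

Lemma bounded_op_eq (S T : bounded_op) : S =1 T -> S = T.
Proof. by move=> ST; apply/val_inj/funext. Qed.

Lemma bounded_opD (S T : bounded_op) x : (S + T) x = S x + T x.
Proof. by []. Qed.

Lemma bounded_opZ k (T : bounded_op) x : (k *: T) x = k *: T x.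
Proof. by []. Qed.

End BoundedOp.

Section OperatorNorm.
Variables (R : realType) (V W : normedModType R[i]).

Definition opnorm (f : V -> W) : R :=
  sup [set rnorm (f x) | x in [set x | rnorm x <= 1]].

Let has (T : bounded_op V W) :
  has_sup [set rnorm (T x) | x in [set x | rnorm x <= 1]].
Proof.
split; first by exists (rnorm (T 0)), 0 => //=; rewrite rnorm0.
have [M M0 TM] := bounded_opP T; exists M => _ [x /= x1 <-].
by rewrite (le_trans (TM x)) // -[leRHS]mulr1 ler_wpM2l.
Qed.

Lemma opnorm_ge0 (T : bounded_op V W) : 0 <= opnorm T.
Proof.
apply: ub_le_sup; first by have [] := has T.
by exists 0; rewrite /= ?rnorm0 // linear0 rnorm0.
Qed.

Lemma opnorm_ub (T : bounded_op V W) x : rnorm (T x) <= opnorm T * rnorm x.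
Proof.
have [/eqP/rnorm0_eq0 ->|x0] := boolP (rnorm x == 0).
  by rewrite linear0 !rnorm0 mulr0.
have px : 0 < rnorm x by rewrite lt_def x0 rnorm_ge0.
rewrite -ler_pdivrMr // mulrC -[X in X * _]ger0_norm ?invr_ge0 ?rnorm_ge0 //.
rewrite -rnormZR -linearZ; apply: ub_le_sup; first by have [] := has T.
exists ((rnorm x)^-1%:C *: x) => //=.
by rewrite rnormZR ger0_norm ?invr_ge0 ?rnorm_ge0 // mulVf.
Qed.

Lemma opnorm_le (T : bounded_op V W) M : 0 <= M ->
  (forall x, rnorm (T x) <= M * rnorm x) -> opnorm T <= M.
Proof.
move=> M0 TM; apply: ge_sup; first by have [] := has T.
move=> _ [x /= x1 <-]; rewrite (le_trans (TM x)) // -[leRHS]mulr1.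
by rewrite ler_wpM2l.
Qed.

Let norm (T : bounded_op V W) : R[i] := (opnorm T)%:C.

Let normD S T : norm (S + T) <= norm S + norm T.
Proof.
rewrite /norm -rmorphD lecR opnorm_le ?addr_ge0 ?opnorm_ge0 // => x.
by rewrite (le_trans (rnormD _ _)) // mulrDl lerD ?opnorm_ub.
Qed.

Let normZ k T : norm (k *: T) = `|k| * norm T.
Proof.
rewrite [`|k|](@ge0_ReE R) // -rmorphM /norm; congr _%:C; apply/eqP.
have k0 : 0 <= complex.Re `|k| by exact: Re_normc_ge0.
have le a (S : bounded_op V W) :
    opnorm (a *: S : bounded_op V W) <= complex.Re `|a| * opnorm S.
  have a0 : 0 <= complex.Re `|a| by exact: Re_normc_ge0.
  apply: opnorm_le; rewrite ?mulr_ge0 ?opnorm_ge0 // => x.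
  by rewrite bounded_opZ rnormZ -mulrA ler_wpM2l ?opnorm_ub.
rewrite eq_le le andTb; have [->|kn0] := eqVneq k 0.
  by rewrite normr0 mul0r scale0r opnorm_ge0.
have := le k^-1 (k *: T); rewrite scalerA mulVf // scale1r => h.
rewrite (le_trans (ler_wpM2l k0 h)) // mulrA.
suff -> : complex.Re `|k| * complex.Re `|k^-1| = 1 by rewrite mul1r.
have := normrM k k^-1; rewrite mulfV // normr1.
rewrite (@ge0_ReE R _ (normr_ge0 k)) (@ge0_ReE R _ (normr_ge0 k^-1)) -rmorphM.
by move/(@complexI R 1).
Qed.

Let norm0_eq0 T : norm T = 0 -> T = 0.
Proof.
move=> /complexI T0; apply: bounded_op_eq => x; apply: rnorm0_eq0.
by apply/eqP; rewrite eq_le rnorm_ge0 (le_trans (opnorm_ub _ _)) // T0 mul0r.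
Qed.

(* In particular the topology of [bounded_op V W] is that of the operator norm. *)
HB.instance Definition _ :=
  @Lmodule_isNormed.Build R[i] (bounded_op V W) norm normD normZ norm0_eq0.

Lemma bounded_op_normE (T : bounded_op V W) : `|T| = (opnorm T)%:C.
Proof. by []. Qed.

End OperatorNorm.

Section Composition.
Variables (R : realType) (U V W : normedModType R[i]).
Variables (T : bounded_op V W) (S : bounded_op U V).

Lemma bcomp_subproof : (T \o S) \in @bounded_linear R U W.
Proof.
apply/bounded_linearP; split; first exact: linearP.
have [M M0 TM] := bounded_opP T; have [N N0 SN] := bounded_opP S.
exists (M * N) => [|x]; first exact: mulr_ge0.
by rewrite (le_trans (TM _)) // -mulrA ler_wpM2l.
Qed.

Definition bcomp := BoundedOp bcomp_subproof.

End Composition.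

Section HilbertTheory.
Variables (R : realType) (H : hilbertType R).
Implicit Types (x y z w : H) (k : R[i]).

Lemma hdotDl x y z : hdot (x + y) z = hdot x z + hdot y z.
Proof. by rewrite -hdotC hdotDr rmorphD /= !hdotC. Qed.

Lemma hdotZl k x y : hdot (k *: x) y = (k^*)%R * hdot x y.
Proof. by rewrite -hdotC hdotZr rmorphM /= hdotC. Qed.

Lemma hdotNr x y : hdot x (- y) = - hdot x y.
Proof. by rewrite -scaleN1r hdotZr mulN1r. Qed.

Lemma hdotNl x y : hdot (- x) y = - hdot x y.
Proof. by rewrite -scaleN1r hdotZl rmorphN rmorph1 mulN1r. Qed.

Lemma hdot_bound x y : complex.Re `|hdot x y| <= 4 * rnorm x * rnorm y.
Proof.
apply: (@sesqui_bound R H (R[i])^o (@hdot R H) hdotDr hdotDl hdotZr hdotZl).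
by move=> u; rewrite hdot_norm normrX normr_id.
Qed.

Lemma hdotxx x : complex.Re (hdot x x) = rnorm x ^+ 2.
Proof. by rewrite hdot_norm rnormE -rmorphXn. Qed.

Lemma hdot_ext x y : (forall z, hdot z x = hdot z y) -> x = y.
Proof.
move=> xy; apply/eqP; rewrite -subr_eq0; apply/eqP/rnorm0_eq0.
have := hdotxx (x - y); rewrite hdotDr hdotNr xy subrr /=.
by move/esym/eqP; rewrite sqrf_eq0 => /eqP.
Qed.

Lemma rnorm_sqrD (t : R) x y :
  rnorm (x + t%:C *: y) ^+ 2 =
  rnorm x ^+ 2 + 2 * t * complex.Re (hdot x y) + t ^+ 2 * rnorm y ^+ 2.
Proof.
rewrite -!hdotxx !hdotDr !hdotDl !hdotZr !hdotZl -(hdotC x y).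
rewrite conj_Creal ?complex_real //.
case: (hdot x x) (hdot x y) (hdot y y) => [a b] [c d] [e f].
by rewrite /=; ring.
Qed.

Theorem riesz_representation (f : bounded_op H (R[i])^o) :
  exists z, forall w, f w = hdot z w.
Proof.
have [M M0 fM] := bounded_opP f.
have fRe w : `|complex.Re (f w)| <= M * rnorm w.
  apply: le_trans (fM w); rewrite -lecR -rnormE.
  exact: (@normc_ge_Re R (f w)).
pose g x := rnorm x ^+ 2 - 2 * complex.Re (f x).
have g_lb x : - (M ^+ 2) <= g x.
  have := fRe x; rewrite ler_norml /g => /andP[_ h].
  have : 0 <= (rnorm x - M) ^+ 2 by rewrite sqr_ge0.
  by rewrite sqrrB; nra.
have g_inf : has_inf (range g).
  by split; [exists (g 0), 0|exists (- (M ^+ 2)) => _ [x _ <-]].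
pose m := inf (range g).
have g_ge x : m <= g x by apply: ge_inf; [case: g_inf|exists x].
have [u uP] : exists u : nat -> H, forall n, g (u n) < m + n.+1%:R^-1.
  have H0 n : exists x, g x < m + n.+1%:R^-1.
    have [] := @inf_adherent R (range g) n.+1%:R^-1 _ g_inf.
      by rewrite invr_gt0 ltr0Sn.
    by move=> _ [x _ <-] xm; exists x.
  by exists (fun n => sval (cid (H0 n))) => n; exact: svalP (cid (H0 n)).
have fD (t : R) x w :
    complex.Re (f (x + t%:C *: w)) = complex.Re (f x) + t * complex.Re (f w).
  rewrite linearD linearZ /=.
  by case: (f x) (f w) => [a b] [c d] /=; rewrite mul0r subr0.
have gD (t : R) x w : g (x + t%:C *: w) = g x +
    2 * t * (complex.Re (hdot x w) - complex.Re (f w)) + t ^+ 2 * rnorm w ^+ 2.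
  by rewrite /g rnorm_sqrD fD; ring.
have eps (e : R) : 0 < e -> exists N, forall n, (N <= n)%N -> n.+1%:R^-1 < e.
  move=> e0; exists (Num.truncn e^-1) => n Nn.
  rewrite invf_plt ?posrE ?ltr0Sn //.
  by rewrite (lt_le_trans (truncnS_gt _)) // ler_nat ltnS.
have close x y : rnorm (x - y) ^+ 2 <= 2 * (g x - m) + 2 * (g y - m).
  have := g_ge (x + (2^-1 : R)%:C *: (y - x)).
  have := gD 1 x (y - x); have := gD 2^-1 x (y - x).
  rewrite scale1r subrKC (rnormB x) => -> ->.
  set a := rnorm _ ^+ 2; set b := _ - _; set c := g x.
  by lra.
have [|z zP] := @rnorm_complete R H u.
  move=> e e0; have e20 : 0 < e ^+ 2 / 4 by rewrite divr_gt0 ?exprn_gt0.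
  have [N NP] := eps _ e20; exists N => p q Np Nq.
  have := close (u p) (u q); have := uP p; have := uP q.
  have := NP _ Np; have := NP _ Nq.
  move: (p.+1%:R^-1) (q.+1%:R^-1) => s t h1 h2 h3 h4 h5.
  have : rnorm (u p - u q) ^+ 2 < e ^+ 2 by lra.
  by rewrite ltr_sqr ?nnegrE ?rnorm_ge0 // ltW.
exists z => w.
have main v : complex.Re (hdot z v) = complex.Re (f v).
  apply/eqP; rewrite -subr_eq0 -normr_le0; apply/ler_addgt0Pl => e e0.
  have [/eqP/rnorm0_eq0 ->|v0] := boolP (rnorm v == 0).
    rewrite linear0 -[X in hdot z X](scale0r (0 : H)) hdotZr mul0r subrr normr0.
    by rewrite addr0 ltW.
  have pv : 0 < rnorm v by rewrite lt_def v0 rnorm_ge0.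
  pose d := e / (2 * rnorm v).
  have d0 : 0 < d by rewrite divr_gt0 ?mulr_gt0.
  have dv : d * rnorm v = e / 2 by rewrite /d; field.
  have [N1 NP1] := eps (d ^+ 2) (exprn_gt0 _ d0).
  have [N2 NP2] := zP (d / 4) (divr_gt0 d0 (ltr0Sn _ _)).
  pose n := maxn N1 N2.
  have h1 := NP1 n (leq_maxl _ _); have h2 := NP2 n (leq_maxr _ _).
  pose c := complex.Re (hdot (u n) v) - complex.Re (f v).
  have hc : `|c| <= e / 2.
    have := g_ge (u n + (- c / rnorm v ^+ 2)%:C *: v).
    rewrite gD -/c; have := uP n; move: (n.+1%:R^-1) h1 => t h1 h3.
    rewrite -addrA; have -> : 2 * (- c / rnorm v ^+ 2) * c +
        (- c / rnorm v ^+ 2) ^+ 2 * rnorm v ^+ 2 = - (c / rnorm v) ^+ 2.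
      by field.
    move=> h4; have : (c / rnorm v) ^+ 2 <= d ^+ 2 by lra.
    rewrite -real_normK ?num_real // ler_sqr ?nnegrE ?(ltW d0) //.
    by rewrite normrM normfV (ger0_norm (ltW pv)) ler_pdivrMr // dv.
  have : `|complex.Re (hdot (z - u n) v)| <= e / 2.
    have h : `|complex.Re (hdot (z - u n) v)| <= complex.Re `|hdot (z - u n) v|.
      by rewrite -lecR -ge0_ReE // normc_ge_Re.
    rewrite (le_trans h) // (le_trans (hdot_bound _ _)) // -dv.
    by rewrite ler_wpM2r ?ltW //; lra.
  rewrite hdotDl hdotNl raddfB /= => h3.
  have -> : complex.Re (hdot z v) - complex.Re (f v) =
    (complex.Re (hdot z v) - complex.Re (hdot (u n) v)) + c by rewrite /c; ring.
  by rewrite (le_trans (ler_normD _ _)) //; lra.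
have := main w; have := main ('i%C *: w).
rewrite hdotZr linearZ /=.
by case: (hdot z w) (f w) => [a b] [c d] /=; rewrite !mul0r !mul1r !sub0r
  => /oppr_inj -> ->.
Qed.

End HilbertTheory.

Section Adjoint.
Variables (R : realType) (H0 H1 : hilbertType R).
Implicit Types T : bounded_op H0 H1.

Lemma adjoint_exists T : exists S : bounded_op H1 H0,
  forall x y, hdot (T x) y = hdot x (S y).
Proof.
have [M M0 TM] := bounded_opP T.
have F y : (fun w => hdot y (T w) : (R[i])^o) \in @bounded_linear R H0 (R[i])^o.
  apply/bounded_linearP; split; first by move=> k u v; rewrite linearP hdotDr hdotZr.
  exists (4 * rnorm y * M) => [|x]; first by rewrite !mulr_ge0 ?rnorm_ge0.
  rewrite (le_trans (hdot_bound _ _)) // -[leRHS]mulrA ler_wpM2l //.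
  by rewrite mulr_ge0 ?rnorm_ge0.
pose s y := sval (cid (riesz_representation (BoundedOp (F y)))).
have sP x y : hdot (T x) y = hdot x (s y).
  rewrite -hdotC -[RHS]hdotC; congr (_^*)%R.
  exact: (svalP (cid (riesz_representation (BoundedOp (F y)))) x).
have sB : s \in @bounded_linear R H1 H0.
  apply/bounded_linearP; split=> [k u v|].
    by apply: hdot_ext => x; rewrite -sP !hdotDr !hdotZr !sP.
  exists (4 * M) => [|y]; first exact: mulr_ge0.
  have [->|n0] := eqVneq (rnorm (s y)) 0; first by rewrite !mulr_ge0 ?rnorm_ge0.
  have p : 0 < rnorm (s y) by rewrite lt_def n0 rnorm_ge0.
  rewrite -(ler_pM2l p) -expr2 -hdotxx -sP.
  have h : complex.Re (hdot (T (s y)) y) <= complex.Re `|hdot (T (s y)) y|.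
    rewrite (le_trans (ler_norm _)) // -lecR -ge0_ReE //.
    exact: normc_ge_Re.
  rewrite (le_trans h) // (le_trans (hdot_bound _ _)) //.
  rewrite (_ : _ * (4 * M * _) = 4 * (M * rnorm (s y)) * rnorm y); last by ring.
  by rewrite ler_wpM2r ?rnorm_ge0 // ler_wpM2l.
by exists (BoundedOp sB).
Qed.

Definition adj T : bounded_op H1 H0 := sval (cid (adjoint_exists T)).

Lemma adjP T x y : hdot (T x) y = hdot x (adj T y).
Proof. exact: (svalP (cid (adjoint_exists T))). Qed.

Lemma adj_unique T (S : bounded_op H1 H0) :
  (forall x y, hdot (T x) y = hdot x (S y)) -> adj T = S.
Proof.
by move=> TS; apply: bounded_op_eq => y; apply: hdot_ext => x; rewrite -adjP TS.
Qed.

End Adjoint.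

Lemma adjPl (R : realType) (H0 H1 : hilbertType R) (T : bounded_op H0 H1) x y :
  hdot (adj T y) x = hdot y (T x).
Proof. by rewrite -hdotC -adjP hdotC. Qed.

Section OperatorStarAlgebra.
Variables (R : realType) (H : hilbertType R).
Implicit Types (S T U : bounded_op H H) (k : R[i]).

Let compA S T U : bcomp S (bcomp T U) = bcomp (bcomp S T) U.
Proof. exact: bounded_op_eq. Qed.

Let compDl S T U : bcomp (S + T) U = bcomp S U + bcomp T U.
Proof. exact: bounded_op_eq. Qed.

Let compDr S T U : bcomp S (T + U) = bcomp S T + bcomp S U.
Proof. by apply: bounded_op_eq => x; exact: linearD. Qed.

Let compZl k S T : bcomp (k *: S) T = k *: bcomp S T.
Proof. exact: bounded_op_eq. Qed.

Let compZr k S T : bcomp S (k *: T) = k *: bcomp S T.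
Proof. by apply: bounded_op_eq => x; exact: linearZ. Qed.

Let adjK T : adj (adj T) = T.
Proof. by apply: adj_unique => x y; exact: adjPl. Qed.

Let adjD S T : adj (S + T) = adj S + adj T.
Proof.
by apply: adj_unique => x y; rewrite !bounded_opD hdotDl hdotDr !adjP.
Qed.

Let adjZ k T : adj (k *: T) = (k^*)%R *: adj T.
Proof.
by apply: adj_unique => x y; rewrite !bounded_opZ hdotZl hdotZr adjP.
Qed.

Let adjM S T : adj (bcomp S T) = bcomp (adj T) (adj S).
Proof. by apply: adj_unique => x y; rewrite /= !adjP. Qed.

HB.instance Definition _ := @isStarAlgebra.Build R (bounded_op H H)
  (@bcomp R H H H) (@adj R H H) compA compDl compDr compZl compZr
  adjK adjD adjZ adjM.

End OperatorStarAlgebra.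

Section HilbertModuleTheory.
Variables (R : realType) (A : cstarAlgType R) (X : hilbertModType A).
Implicit Types (x y z : X) (a b : A) (k : R[i]).

Lemma minnerDl x y z : minner (x + y) z = minner x z + minner y z.
Proof. by rewrite -minnerC minnerDr starD !minnerC. Qed.

Lemma minnerZl k x y : minner (k *: x) y = (k^*)%R *: minner x y.
Proof. by rewrite -minnerC minnerZr starZ minnerC. Qed.

Lemma minnerMl x y a : minner (mact x a) y = smul (star a) (minner x y).
Proof. by rewrite -minnerC minnerMr starM minnerC. Qed.

Lemma minner_bound x y : rnorm (minner x y) <= 4 * rnorm x * rnorm y.
Proof.
exact: (@sesqui_bound R X A (@minner R A X) minnerDr minnerDl
  minnerZr minnerZl minner_norm).
Qed.

Lemma rnorm_minner x : rnorm (minner x x) = rnorm x ^+ 2.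
Proof. by apply: complexI; rewrite -rnormE minner_norm rnormE rmorphXn. Qed.

Lemma minner_ext x y : (forall z, minner z x = minner z y) -> x = y.
Proof.
move=> xy; apply/eqP; rewrite -subr_eq0; apply/eqP/rnorm0_eq0/eqP.
rewrite -sqrf_eq0 -rnorm_minner -scaleN1r minnerDr minnerZr xy !scaleN1r subrr.
by rewrite rnorm0.
Qed.

End HilbertModuleTheory.

Section Adjointable.
Variables (R : realType) (A : cstarAlgType R) (X : hilbertModType A).

Definition has_adjoint : {pred X -> X} := fun T =>
  `[< exists S : X -> X, forall x y, minner (T x) y = minner x (S y) >].

Lemma has_adjoint_closed : submod_closed has_adjoint.
Proof.
split=> [|k f g /asboolP[f' ff'] /asboolP[g' gg']]; apply/asboolP.
  exists (fun=> 0) => x y; change (minner (0 : X) y = minner x 0).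
  by rewrite -(scale0r (0 : X)) minnerZl minnerZr rmorph0 !scale0r.
exists (fun y => (k^*)%R *: f' y + g' y) => x y.
change (minner (k *: f x + g x) y = minner x ((k^*)%R *: f' y + g' y)).
by rewrite minnerDl minnerZl minnerDr minnerZr ff' gg'.
Qed.

HB.instance Definition _ :=
  GRing.isSubmodClosed.Build R[i] (X -> X) has_adjoint has_adjoint_closed.

Record adjointable :=
  Adjointable {adjointable_fun :> X -> X; _ : adjointable_fun \in has_adjoint}.

HB.instance Definition _ := [isSub for adjointable_fun].
HB.instance Definition _ := [Choice of adjointable by <:].
HB.instance Definition _ := [SubChoice_isSubLmodule of adjointable by <:].

Implicit Types (S T U : adjointable) (k : R[i]).

Lemma adjointable_eq S T : S =1 T -> S = T.
Proof. by move=> ST; apply/val_inj/funext. Qed.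

Lemma adjointableD S T x : (S + T) x = S x + T x.
Proof. by []. Qed.

Lemma adjointableZ k T x : (k *: T) x = k *: T x.
Proof. by []. Qed.

Lemma madj_exists T : exists S : adjointable,
  forall x y, minner (T x) y = minner x (S y).
Proof.
case: T => f /= /[dup] fP /asboolP[g fg].
suff gP : g \in has_adjoint by exists (Adjointable gP).
by apply/asboolP; exists f => x y; rewrite -minnerC -fg minnerC.
Qed.

Definition madj T : adjointable := sval (cid (madj_exists T)).

Lemma madjP T x y : minner (T x) y = minner x (madj T y).
Proof. exact: (svalP (cid (madj_exists T))). Qed.

Lemma madjPl T x y : minner (madj T y) x = minner y (T x).
Proof. by rewrite -minnerC -madjP minnerC. Qed.

Lemma madj_unique T S :
  (forall x y, minner (T x) y = minner x (S y)) -> madj T = S.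
Proof.
move=> TS; apply: adjointable_eq => y; apply: minner_ext => x.
by rewrite -madjP TS.
Qed.

Lemma adjointable_linear T : linear T.
Proof.
move=> k x y; apply: minner_ext => z.
by rewrite minnerDr minnerZr -!madjPl minnerDr minnerZr.
Qed.

HB.instance Definition _ T :=
  GRing.isLinear.Build R[i] X X *:%R T (@adjointable_linear T).

Lemma adjointable_mact T x a : T (mact x a) = mact (T x) a.
Proof. by apply: minner_ext => z; rewrite minnerMr -!madjPl minnerMr. Qed.

Lemma adjointable_bounded T : (T : X -> X) \in @bounded_linear R X X.
Proof.
apply/bounded_linearP; split; first exact: linearP.
pose p y x : R := rnorm (minner y (T x)) / rnorm y.
have pE y x : p y x * rnorm y = rnorm (minner y (T x)).
  rewrite /p; have [/rnorm0_eq0 ->|y0] := eqVneq (rnorm y) 0; last exact: divfK.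
  by rewrite -(scale0r (0 : X)) minnerZl rmorph0 !scale0r !rnorm0 mulr0.
have V0 y : 0 <= (rnorm y)^-1 :> R by rewrite invr_ge0 rnorm_ge0.
have [||||x|M M0 MP] := @ubp R X X p.
- move=> y u v; rewrite /p linearD minnerDr -mulrDl ler_wpM2r //.
  exact: rnormD.
- move=> y u; rewrite /p -scaleN1r linearZ minnerZr scaleN1r rnormN //.
- by move=> y t u; rewrite /p linearZ minnerZr rnormZR mulrA.
- move=> y; exists (4 * rnorm (madj T y) / rnorm y) => x.
  rewrite /p -madjPl mulrAC ler_wpM2r //.
  exact: minner_bound.
- exists (4 * rnorm (T x)) => y; rewrite /p.
  have [->|y0] := eqVneq (rnorm y) 0.
    by rewrite invr0 mulr0 mulr_ge0 ?rnorm_ge0.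
  rewrite ler_pdivrMr ?lt_def ?y0 ?rnorm_ge0 // mulrAC.
  exact: minner_bound.
exists M => // x; have := MP (T x) x.
have [->|y0] := eqVneq (rnorm (T x)) 0; first by rewrite mulr_ge0 ?rnorm_ge0.
by rewrite /p rnorm_minner expr2 mulfK.
Qed.

Definition adjointable_bounded_op T := BoundedOp (adjointable_bounded T).

Let norm T : R[i] := (opnorm T)%:C.

Let normE T : norm T = `|adjointable_bounded_op T|.
Proof. by []. Qed.

Let normD S T : norm (S + T) <= norm S + norm T.
Proof.
exact: ler_normD (adjointable_bounded_op S) (adjointable_bounded_op T).
Qed.

Let normZ k T : norm (k *: T) = `|k| * norm T.
Proof. exact: normrZ k (adjointable_bounded_op T). Qed.

Let norm0_eq0 T : norm T = 0 -> T = 0.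
Proof.
rewrite normE => /normr0_eq0 T0; apply: adjointable_eq => x.
by have := congr1 (fun U : bounded_op X X => U x) T0.
Qed.

HB.instance Definition _ :=
  @Lmodule_isNormed.Build R[i] adjointable norm normD normZ norm0_eq0.

Lemma adjointable_normE T : `|T| = (opnorm T)%:C.
Proof. by []. Qed.

Lemma acomp_subproof S T : (S \o T : X -> X) \in has_adjoint.
Proof.
by apply/asboolP; exists (madj T \o madj S) => x y; rewrite /= !madjP.
Qed.

Definition acomp S T := Adjointable (acomp_subproof S T).

Let compA S T U : acomp S (acomp T U) = acomp (acomp S T) U.
Proof. exact: adjointable_eq. Qed.

Let compDl S T U : acomp (S + T) U = acomp S U + acomp T U.
Proof. exact: adjointable_eq. Qed.

Let compDr S T U : acomp S (T + U) = acomp S T + acomp S U.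
Proof. by apply: adjointable_eq => x; exact: linearD. Qed.

Let compZl k S T : acomp (k *: S) T = k *: acomp S T.
Proof. exact: adjointable_eq. Qed.

Let compZr k S T : acomp S (k *: T) = k *: acomp S T.
Proof. by apply: adjointable_eq => x; exact: linearZ. Qed.

Let madjK T : madj (madj T) = T.
Proof. by apply: madj_unique => x y; exact: madjPl. Qed.

Let madjD S T : madj (S + T) = madj S + madj T.
Proof.
by apply: madj_unique => x y; rewrite !adjointableD minnerDl minnerDr !madjP.
Qed.

Let madjZ k T : madj (k *: T) = (k^*)%R *: madj T.
Proof.
by apply: madj_unique => x y; rewrite !adjointableZ minnerZl minnerZr madjP.
Qed.

Let madjM S T : madj (acomp S T) = acomp (madj T) (madj S).
Proof. by apply: madj_unique => x y; rewrite /= !madjP. Qed.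

HB.instance Definition _ := @isStarAlgebra.Build R adjointable
  acomp madj compA compDl compDr compZl compZr madjK madjD madjZ madjM.

Lemma theta_subproof x y : (fun z => mact x (minner y z)) \in has_adjoint.
Proof.
apply/asboolP; exists (fun w => mact y (minner x w)) => z w.
by rewrite minnerMl minnerMr minnerC.
Qed.

Definition theta x y : adjointable := Adjointable (theta_subproof x y).

End Adjointable.

Section StarMorphism.
Variables (R : realType) (A B : starAlgType R).

Definition star_hom (f : A -> B) :=
  [/\ linear f, forall a b, f (smul a b) = smul (f a) (f b) &
      forall a, f (star a) = star (f a)].

Definition star_subalgebra (C : starAlgType R) (D : set C) :=
  [/\ D 0, forall k a b, D a -> D b -> D (k *: a + b),
      forall a b, D a -> D b -> D (smul a b) & forall a, D a -> D (star a)].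

(* The values of [f] outside [D] are irrelevant. *)
Definition star_iso (D : set A) (E : set B) (f : A -> B) :=
  [/\ star_subalgebra D, star_subalgebra E, set_bij D E f &
   [/\ forall k a b, D a -> D b -> f (k *: a + b) = k *: f a + f b,
       forall a b, D a -> D b -> f (smul a b) = smul (f a) (f b) &
       forall a, D a -> f (star a) = star (f a)]].

End StarMorphism.

(* All finite linear combinations, [n = 0] giving the zero vector. *)
Definition lspan (K : pzRingType) (V : lmodType K) (S : set V) : set V :=
  [set v | exists (n : nat) (k : 'I_n -> K) (s : 'I_n -> V),
     (forall i, S (s i)) /\ v = \sum_(i < n) k i *: s i].

Definition compacts (R : realType) (A : cstarAlgType R) (X : hilbertModType A) :
    set (adjointable X) :=
  closure (lspan [set theta x y | x in [set: X] & y in [set: X]]).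

Arguments compacts {R A} X _.

Section Representation.
Variables (R : realType) (A : cstarAlgType R) (X : hilbertModType A).
Variables (H0 H1 : hilbertType R).
Variables (rho : A -> bounded_op H0 H0) (pi : X -> bounded_op H0 H1).

Definition hmod_representation :=
  [/\ star_hom rho, linear pi,
      forall x a, pi (mact x a) = bcomp (pi x) (rho a) &
      forall x y, rho (minner x y) = bcomp (adj (pi x)) (pi y)].

Lemma hmod_representation_inj :
  hmod_representation -> injective rho -> injective pi.
Proof.
move=> [[rhoL _ _] piL _ piI] rho_inj x y pixy.
have piB : pi (x - y) = 0.
  have -> : x - y = -1 *: y + x by rewrite scaleN1r addrC.
  by rewrite piL pixy scaleN1r addNr.
have rho0 : rho 0 = 0.
  by have := rhoL (-1) 0 0; rewrite scaler0 addr0 scaleN1r addNr.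
have z0 : minner (x - y) (x - y) = 0.
  apply: rho_inj; rewrite piI piB rho0; apply: bounded_op_eq => v.
  exact: linear0.
apply/eqP; rewrite -subr_eq0; apply/eqP/rnorm0_eq0/eqP.
by rewrite -sqrf_eq0 -rnorm_minner z0 rnorm0.
Qed.

End Representation.

(* Main.v *)
Require Import Defs.
From HB Require Import structures.
From mathcomp Require Import all_boot all_order all_algebra.
From mathcomp Require Import complex ring lra.
From mathcomp Require Import all_classical all_reals all_analysis.

Set Implicit Arguments.
Unset Strict Implicit.
Unset Printing Implicit Defensive.

Import Order.TTheory GRing.Theory Num.Theory.
Import numFieldNormedType.Exports.

Local Open Scope classical_set_scope.
Local Open Scope ring_scope.

(** An adjointable operator [T] should act on the Hilbert space [H1] by
    [pi x xi |-> pi (T x) xi].  Write [induced_op T] for this operator.  Both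
    parts of the theorem are statements about the map [induced_op]: it is an
    injective star-homomorphism that sends [theta x y] to
    [pi x (pi y)^*], its range is the algebra [B] of part 2 ([range_induced]),
    and it maps the compact operators onto the closed span of the
    [pi x (pi y)^*] ([induced_compacts]).  The map of part 2 is its inverse.

    Two points need an argument.  The first is that [induced_op T] exists, that
    is, that the prescription is bounded on the dense span.  The second is that
    [induced_op] is bounded below, without which the image of the compact
    operators might fail to be closed.  Both rest on square roots in the unital
    algebra of adjointable operators: if [N] is self-adjoint with
    [|N| <= t^2], then [t^2 - N] has a self-adjoint square root, obtained by
    a convergent iteration ([adjointable_sqrt]).

    Boundedness: if [|T^* T| <= M^2] and [K] is the square root of
    [M^2 - T^* T], then for every vector [v] in the span
    [M^2 |v|^2 - |T v|^2 = <v, K^2 v> = |K v|^2 >= 0] ([ev_act_bound]).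

    Boundedness below: for self-adjoint [T] and [s > |induced_op T|], the image
    of [s^2 - T^2] is strictly positive on [H1], so it equals its absolute
    value.  The absolute value can be formed from square roots before passing
    to [H1]; injectivity then shows that [s^2 - T^2] itself has a square root
    [h].  From [T^2 + h^2 = s^2] one gets [|T| <= s], because [T + ih] and
    [T - ih] are [s] times isometries ([induced_isometric]).  The case of a
    general [T] follows through [T^* T].  This argument replaces the continuous
    functional calculus in the usual proof that injective star-homomorphisms of
    C*-algebras are isometric. *)

Local Open Scope complex_scope.

(** * Approximation in norm, and closed linear spans *)

Section Approximation.
Variables (R : realType) (V : normedModType R[i]).
Implicit Types (S : set V) (x : V).

Lemma closure_rnormP S x :
  closure S x <-> forall e : R, 0 < e -> exists2 s, S s & rnorm (x - s) < e.
Proof.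
split=> [Sx e e0|Sx U /nbhs_ballP[e /= e0 xeU]].
  have [|s [Ss]] := Sx (ball x e%:C); first by apply: nbhsx_ballx; rewrite ltcR.
  by rewrite -ball_normE /ball_ /= rnormE ltcR; exists s.
have eE := ge0_ReE (ltW e0).
have [|s Ss xs] := Sx (complex.Re e); first by rewrite -ltcR -eE.
exists s; split => //; apply: xeU; rewrite -ball_normE /ball_ /= rnormE.
by rewrite eE ltcR.
Qed.

Lemma dense_rnormP S x (e : R) : dense S -> 0 < e ->
  exists2 s, S s & rnorm (x - s) < e.
Proof.
move=> Sd e0; have e0' : 0 < e%:C :> R[i] by rewrite ltcR.
have [||s [xs Ss]] := Sd (ball x e%:C).
- by exists x; exact: ballxx.
- exact: ball_open.
by exists s => //; move: xs; rewrite -ball_normE /ball_ /= rnormE ltcR.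
Qed.

Lemma rnorm_le_eq0 x : (forall e : R, 0 < e -> rnorm x <= e) -> x = 0.
Proof.
move=> xe; apply: rnorm0_eq0; apply/eqP; rewrite eq_le rnorm_ge0 andbT.
by apply/ler_addgt0Pl => e e0; rewrite addr0 xe.
Qed.

(** The modulus [d] depends on [k] and [e] only, so that one choice serves
    several spaces simultaneously: for a linear relation, the source and the
    target. *)
Lemma rnorm_lin_near (k : R[i]) (e : R) : 0 < e ->
  exists2 d : R, 0 < d & forall (E : normedModType R[i]) (a a' p p' : E),
    rnorm (a - p) < d -> rnorm (a' - p') < d ->
    rnorm (k *: a + a' - (k *: p + p')) < e.
Proof.
move=> e0; pose c := complex.Re `|k| + 1.
have c0 : 0 < c by rewrite /c ltr_wpDl // Re_normc_ge0.
exists (e / c); first by rewrite divr_gt0.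
have cE : complex.Re `|k| * (e / c) + e / c = e.
  by rewrite /c; field; rewrite -/c gt_eqF.
move=> E a a' p p' ap ap'.
rewrite opprD addrACA -scalerBr (le_lt_trans (rnormD _ _)) //.
by rewrite -cE rnormZ ler_ltD // ler_wpM2l ?Re_normc_ge0 // ltW.
Qed.

Lemma closure_lin_closed S :
  (forall k x y, S x -> S y -> S (k *: x + y)) ->
  forall k x y, closure S x -> closure S y -> closure S (k *: x + y).
Proof.
move=> Slin k x y /closure_rnormP Sx /closure_rnormP Sy.
apply/closure_rnormP => e /(rnorm_lin_near k)[d d0 dP].
have [p Sp xp] := Sx d d0; have [q Sq yq] := Sy d d0.
by exists (k *: p + q); [exact: Slin|exact: dP].
Qed.

End Approximation.

(** The tool for extending products, adjoints and images from a linear span to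
    its closure. *)
Lemma closure_lipschitz (R : realType) (V W : normedModType R[i]) (S : set V)
    (S' : set W) (f : V -> W) (M : R) : 0 <= M ->
  (forall x y, rnorm (f x - f y) <= M * rnorm (x - y)) ->
  (forall x, S x -> S' (f x)) ->
  forall x, closure S x -> closure S' (f x).
Proof.
move=> M0 fM SS' x /closure_rnormP Sx; apply/closure_rnormP => e e0.
have c0 : 0 < M + 1 by rewrite ltr_wpDl.
have [s Ss xs] := Sx (e / (M + 1)) (divr_gt0 e0 c0).
exists (f s); first exact: SS'.
have := divfK (lt0r_neq0 c0) e; have := fM x s; have := rnorm_ge0 (x - s).
move: (e / _) xs => e' xs; nra.
Qed.

Section LinearSpan.
Variables (K : pzRingType) (V : lmodType K) (S : set V).

Lemma lspan_lin k x y : lspan S x -> lspan S y -> lspan S (k *: x + y).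
Proof.
move=> [n [c [s [sS ->]]]] [m [d [t [tS ->]]]].
exists (n + m)%N,
  (fun i : 'I_(n + m) =>
     match fintype.split i with inl j => k * c j | inr j => d j end),
  (fun i : 'I_(n + m) =>
     match fintype.split i with inl j => s j | inr j => t j end).
split=> [i|]; first by case: fintype.split.
rewrite big_split_ord scaler_sumr; congr (_ + _); apply: eq_bigr => i _.
  by rewrite (unsplitK (inl i)) scalerA.
by rewrite (unsplitK (inr i)).
Qed.

Lemma lspan0 : lspan S 0.
Proof. by exists 0%N, (fun=> 0), (fun=> 0); split=> [[]|]; rewrite ?big_ord0. Qed.

Lemma lspan_mem x : S x -> lspan S x.
Proof.
move=> Sx; exists 1%N, (fun=> 1), (fun=> x); split=> //.
by rewrite big_ord1 scale1r.
Qed.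

Lemma lspan_min (D : set V) : D 0 ->
  (forall k x y, D x -> D y -> D (k *: x + y)) ->
  (forall x, S x -> D x) -> forall x, lspan S x -> D x.
Proof.
move=> D0 Dlin SD _ [n [k [s [sS ->]]]].
apply: big_ind => // [x y Dx Dy|i _]; first by rewrite -[x]scale1r; exact: Dlin.
by rewrite -[_ *: _]addr0; apply: Dlin => //; exact: SD.
Qed.

End LinearSpan.

Lemma inv_succ_lt (R : realType) (e : R) : 0 < e ->
  exists N, forall n, (N <= n)%N -> n.+1%:R^-1 < e.
Proof.
move=> e0; exists (Num.truncn e^-1) => n Nn.
rewrite invf_plt ?posrE ?ltr0Sn //.
by rewrite (lt_le_trans (truncnS_gt _)) // ler_nat ltnS.
Qed.

(** * Norm estimates for operators on Hilbert spaces and Hilbert modules *)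

Section OperatorBounds.
Variables (R : realType).

Lemma op_rnorm_ub (V W : normedModType R[i]) (b : bounded_op V W) x :
  rnorm (b x) <= rnorm b * rnorm x.
Proof. exact: opnorm_ub. Qed.

Lemma op_rnorm_le (V W : normedModType R[i]) (b : bounded_op V W) M : 0 <= M ->
  (forall x, rnorm (b x) <= M * rnorm x) -> rnorm b <= M.
Proof. exact: opnorm_le. Qed.

Lemma bcomp_rnorm (U V W : normedModType R[i]) (S : bounded_op V W)
    (T : bounded_op U V) : rnorm (bcomp S T) <= rnorm S * rnorm T.
Proof.
apply: op_rnorm_le => [|x]; first by rewrite mulr_ge0 ?rnorm_ge0.
rewrite (le_trans (op_rnorm_ub S (T x))) // -mulrA.
by rewrite ler_wpM2l ?rnorm_ge0 // op_rnorm_ub.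
Qed.

(** The Cauchy-Schwarz inequality is only used up to a constant; the factor 4
    is that of polarization. *)
Lemma rnorm_sqr_hdot_le (H H' : hilbertType R) (x : H) (y z : H') :
  hdot x x = hdot y z -> rnorm x ^+ 2 <= 4 * rnorm y * rnorm z.
Proof.
move=> xyz; rewrite -hdotxx xyz (le_trans _ (hdot_bound _ _)) //.
rewrite (le_trans (ler_norm _)) // -lecR -ge0_ReE //; exact: normc_ge_Re.
Qed.

(** Divide [|b^* y|^2 = <y, b (b^* y)> <= 4 |y| |b| |b^* y|] by [|b^* y|]. *)
Lemma adj_rnorm (H0 H1 : hilbertType R) (b : bounded_op H0 H1) :
  rnorm (adj b) <= 4 * rnorm b.
Proof.
apply: op_rnorm_le => [|y]; first by rewrite mulr_ge0 ?rnorm_ge0.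
have [->|y0] := eqVneq (rnorm (adj b y)) 0.
  by rewrite !mulr_ge0 ?rnorm_ge0.
have p : 0 < rnorm (adj b y) by rewrite lt_def y0 rnorm_ge0.
have := rnorm_sqr_hdot_le (adjPl b (adj b y) y).
have := op_rnorm_ub b (adj b y); have := rnorm_ge0 y; nra.
Qed.

End OperatorBounds.

Section AdjointableOperators.
Variables (R : realType) (A : cstarAlgType R) (X : hilbertModType A).
Implicit Types (S T : adjointable X) (x y z : X) (k : R[i]) (t : R).

Lemma adjointable_rnorm_ub T x : rnorm (T x) <= rnorm T * rnorm x.
Proof. exact: opnorm_ub (adjointable_bounded_op T) x. Qed.

Lemma adjointable_rnorm_le T (M : R) : 0 <= M ->
  (forall x, rnorm (T x) <= M * rnorm x) -> rnorm T <= M.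
Proof. exact: (@opnorm_le R X X (adjointable_bounded_op T)). Qed.

Lemma acomp_rnorm S T : rnorm (acomp S T) <= rnorm S * rnorm T.
Proof.
apply: adjointable_rnorm_le => [|x]; first by rewrite mulr_ge0 ?rnorm_ge0.
rewrite (le_trans (adjointable_rnorm_ub S (T x))) // -mulrA.
by rewrite ler_wpM2l ?rnorm_ge0 // adjointable_rnorm_ub.
Qed.

Lemma rnorm_sqr_minner_le x y z :
  minner x x = minner y z -> rnorm x ^+ 2 <= 4 * rnorm y * rnorm z.
Proof. by move=> xyz; rewrite -rnorm_minner xyz minner_bound. Qed.

Lemma madj_rnorm T : rnorm (madj T) <= 4 * rnorm T.
Proof.
apply: adjointable_rnorm_le => [|y]; first by rewrite mulr_ge0 ?rnorm_ge0.
have [->|y0] := eqVneq (rnorm (madj T y)) 0.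
  by rewrite !mulr_ge0 ?rnorm_ge0.
have p : 0 < rnorm (madj T y) by rewrite lt_def y0 rnorm_ge0.
have := rnorm_sqr_minner_le (madjPl T (madj T y) y).
have := adjointable_rnorm_ub T (madj T y); have := rnorm_ge0 y; nra.
Qed.

(** The C*-identity up to a constant, from
    [|T x|^2 = |<x, T^* T x>| <= 4 |x| |T^* T x|]. *)
Lemma rnorm_sqr_madj T : rnorm T ^+ 2 <= 4 * rnorm (acomp (madj T) T).
Proof.
rewrite -[leRHS]sqr_sqrtr ?mulr_ge0 ?rnorm_ge0 //.
rewrite ler_sqr ?nnegrE ?sqrtr_ge0 ?rnorm_ge0 //.
apply: adjointable_rnorm_le => [|x]; first exact: sqrtr_ge0.
rewrite -ler_sqr ?nnegrE ?mulr_ge0 ?sqrtr_ge0 ?rnorm_ge0 //.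
rewrite exprMn sqr_sqrtr ?mulr_ge0 ?rnorm_ge0 //.
have := rnorm_sqr_minner_le (madjP T x (T x)).
move/le_trans; apply.
have := adjointable_rnorm_ub (acomp (madj T) T) x; rewrite /=.
by have := rnorm_ge0 x; nra.
Qed.

Lemma adjointable_id_subproof : idfun \in @has_adjoint R A X.
Proof. by apply/asboolP; exists idfun. Qed.

Definition adjointable_id : adjointable X := Adjointable adjointable_id_subproof.

Lemma minnerBl x y z : minner (x - y) z = minner x z - minner y z.
Proof. by rewrite -scaleN1r minnerDl minnerZl rmorphN1 scaleN1r. Qed.

Lemma minnerBr x y z : minner x (y - z) = minner x y - minner x z.
Proof. by rewrite -scaleN1r minnerDr minnerZr scaleN1r. Qed.

Lemma adjointableB S T x : (S - T) x = S x - T x.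
Proof. by []. Qed.

Lemma madjB S T : madj (S - T) = madj S - madj T.
Proof.
by apply: madj_unique => x y; rewrite !adjointableB minnerBl minnerBr !madjP.
Qed.

Lemma self_adjointP T :
  madj T = T <-> forall x y, minner (T x) y = minner x (T y).
Proof. by split=> [TT x y|]; [rewrite madjP TT|exact: madj_unique]. Qed.

(** A Cauchy sequence [u] of operators converges pointwise, uniformly on
    bounded sets, and so does the sequence of its adjoints because
    [|T^*| <= 4 |T|].  The two limits are adjoint to each other, and this makes
    the limit of [u] adjointable. *)
Lemma adjointable_complete (u : nat -> adjointable X) :
  (forall e : R, 0 < e ->
     exists N, forall m n, (N <= m)%N -> (N <= n)%N -> rnorm (u m - u n) < e) ->
  exists T, forall e : R, 0 < e ->
     exists N, forall n, (N <= n)%N -> rnorm (T - u n) <= e.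
Proof.
move=> uC.
have lim (v : nat -> adjointable X) : (forall e : R, 0 < e ->
     exists N, forall m n, (N <= m)%N -> (N <= n)%N -> rnorm (v m - v n) < e) ->
   exists f : X -> X, forall e : R, 0 < e -> exists N, forall n, (N <= n)%N ->
      forall x, rnorm (f x - v n x) <= e * rnorm x.
  move=> vC.
  have pt x : exists z, forall e : R, 0 < e ->
      exists N, forall n, (N <= n)%N -> rnorm (z - v n x) < e.
    apply: rnorm_complete => e e0.
    have d0 : 0 < rnorm x + 1 by rewrite ltr_wpDl ?rnorm_ge0.
    have [N vN] := vC (e / (rnorm x + 1)) (divr_gt0 e0 d0).
    exists N => m n Nm Nn; have := adjointable_rnorm_ub (v m - v n) x.
    move/le_lt_trans; apply; have := vN m n Nm Nn.
    rewrite ltr_pdivlMr //; have := rnorm_ge0 (v m - v n); have := rnorm_ge0 x.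
    by move=> ? ?; apply: le_lt_trans; rewrite ler_wpM2l // lerDl.
  have [f fP] := choice pt.
  exists f => e e0; have [N vN] := vC e e0; exists N => n Nn x.
  apply/ler_addgt0Pl => d /(fP x)[M fM].
  have := fM _ (leq_maxr N M).
  have := adjointable_rnorm_ub (v (maxn N M) - v n) x.
  have := vN _ _ (leq_maxl N M) Nn => h1 h2 h3.
  have := rnormD (f x - v (maxn N M) x) (v (maxn N M) x - v n x).
  rewrite subrKA => h4; have := rnorm_ge0 x; move: h2 => /= h2.
  have := ler_wpM2r (rnorm_ge0 x) (ltW h1).
  have : rnorm (v (maxn N M) x - v n x) <=
    rnorm (v (maxn N M) - v n) * rnorm x by [].
  lra.
have [f fP] := lim u uC.
have [g gP] : exists g : X -> X, forall e : R, 0 < e ->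
    exists N, forall n, (N <= n)%N ->
      forall x, rnorm (g x - madj (u n) x) <= e * rnorm x.
  apply: lim => e e0; have [N uN] := uC (e / 4) (divr_gt0 e0 (ltr0Sn _ _)).
  exists N => m n Nm Nn.
  rewrite -madjB; have := madj_rnorm (u m - u n); have := uN m n Nm Nn; lra.
have fgP x y : minner (f x) y = minner x (g y).
  apply/eqP; rewrite -subr_eq0; apply/eqP/rnorm_le_eq0 => e e0.
  pose c := 8 * rnorm x * rnorm y + 1.
  have xy0 : 0 <= rnorm x * rnorm y by rewrite mulr_ge0 ?rnorm_ge0.
  have c0 : 0 < c by rewrite /c; lra.
  have d0 : 0 < e / c by rewrite divr_gt0.
  have [N1 fN] := fP _ d0; have [N2 gN] := gP _ d0.
  have := fN _ (leq_maxl N1 N2) x; have := gN _ (leq_maxr N1 N2) y.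
  move: (maxn N1 N2) => n gn fn.
  have -> : minner (f x) y - minner x (g y) =
      minner (f x - u n x) y - minner x (g y - madj (u n) y).
    by rewrite minnerBl minnerBr madjP opprB addrA subrK.
  rewrite (le_trans (rnormD _ _)) // rnormN.
  have h1 := minner_bound (f x - u n x) y.
  have h2 := minner_bound x (g y - madj (u n) y).
  have h3 := ler_wpM2r (rnorm_ge0 y) fn.
  have h4 := ler_wpM2l (rnorm_ge0 x) gn.
  have : e / c * c = e by rewrite divfK // gt_eqF.
  rewrite {2}/c; lra.
have fA : f \in @has_adjoint R A X by apply/asboolP; exists g.
exists (Adjointable fA) => e e0; have [N fN] := fP e e0.
exists N => n Nn; apply: adjointable_rnorm_le; first exact: ltW.
exact: fN.
Qed.

(** As [S] and [T] commute, [S + iT] and [S - iT] are [t] times isometries: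
    [|S x + i T x|^2 = |<x, (S^2 + T^2) x>| = t^2 |x|^2].  Their half-sum [S]
    therefore has norm at most [t].  This replaces the fact that
    [0 <= S^2 <= t^2] bounds the norm of [S], which would need a theory of
    positive elements. *)
Lemma rnorm_le_of_sqr_sum S T t : madj S = S -> madj T = T -> 0 <= t ->
  (forall x, S (T x) = T (S x)) ->
  (forall x, S (S x) + T (T x) = (t ^+ 2)%:C *: x) ->
  rnorm S <= t.
Proof.
move=> /self_adjointP SS /self_adjointP TT t0 ST STt.
apply: adjointable_rnorm_le => // x.
have iso k : k * k^*%R = 1 -> k + k^*%R = 0 ->
    rnorm (S x + k *: T x) = t * rnorm x.
  move=> kk kD; apply/eqP.
  rewrite -(@eqrXn2 _ 2) ?mulr_ge0 ?rnorm_ge0 // exprMn -!rnorm_minner.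
  rewrite !minnerDl !minnerDr !minnerZl !minnerZr !SS !TT ST scalerA.
  rewrite [k^*%R * k]mulrC kk scale1r addrA -[_ + _ + _ *: _]addrA -scalerDl.
  rewrite kD scale0r addr0 -minnerDr STt minnerZr rnormZR ger0_norm //.
  exact: sqr_ge0.
have ii : 'i%C * ('i%C)^*%R = 1 :> R[i] by rewrite -normCK normc_def /=
  expr0n expr1n /= add0r sqrtr1 expr1n.
have i0 : 'i%C + ('i%C)^*%R = 0 :> R[i].
  by apply/eqP; rewrite eq_complex /= addr0 subrr !eqxx.
have h1 := iso _ ii i0.
have h2 : rnorm (S x + - 'i%C *: T x) = t * rnorm x.
  by apply: iso; rewrite rmorphN ?mulrNN // -opprD i0 oppr0.
have : rnorm (2%:R%:C *: S x) <= t * rnorm x + t * rnorm x.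
  rewrite -{1}h1 -h2 (le_trans _ (rnormD _ _)) // addrACA -scalerDl subrr.
  by rewrite scale0r addr0 rmorph_nat scaler_nat mulr2n.
by rewrite rnormZR normr_nat; lra.
Qed.

End AdjointableOperators.

(** * Square roots of adjointable operators *)

Lemma nondecreasing_bounded_cauchy (R : realType) (d : nat -> R) (M : R) :
  (forall n, d n <= d n.+1) -> (forall n, d n <= M) ->
  forall e : R, 0 < e ->
  exists N, forall m n, (N <= m)%N -> (N <= n)%N -> `|d m - d n| < e.
Proof.
move=> dS dM e e0.
have ndd : {homo d : m n / (m <= n)%N >-> m <= n}.
  by apply: homo_leq => //; exact: le_trans.
have Ds : has_sup (range d).
  by split; [exists (d 0%N), 0%N|exists M => _ [n _ <-]].
have [_ [N _ <-] dN] := sup_adherent e0 Ds.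
exists N => m n Nm Nn.
have ub k : d k <= sup (range d) by apply: ub_le_sup; [case: Ds|exists k].
have := ndd _ _ Nm; have := ndd _ _ Nn; have := ub m; have := ub n.
by rewrite ltr_distl; lra.
Qed.

Section SquareRoot.
Variables (R : realType) (A : cstarAlgType R) (X : hilbertModType A).
Implicit Types (S T N C K : adjointable X) (x y z : X) (t : R).

(** The positive square root of [t^2 - N], written [K = t + C].  The equation
    for [C] is [C^2 + 2 t C = - N]; it is solved by iterating
    [f c = - (N + c^2) / (2 t)] from [0].  The scalar iteration
    [g s = (t^2 + s^2) / (2 t)] from [0] increases and stays below [t], and it
    dominates the former step by step, which gives convergence even in the
    critical case [|N| = t^2].  The bound [|K - t| <= t] is a form of positivity
    that any bounded representation preserves.  As a limit of polynomials in
    [N], the root commutes with all that commutes with [N]. *)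
Lemma adjointable_sqrt N t : 0 < t -> madj N = N -> rnorm N <= t ^+ 2 ->
  exists K, [/\ madj K = K,
    forall x, K (K x) = (t ^+ 2)%:C *: x - N x,
    rnorm (K - t%:C *: adjointable_id X) <= t &
    forall S, (forall x, S (N x) = N (S x)) -> forall x, S (K x) = K (S x)].
Proof.
move=> t0 NN Nt.
pose f c : adjointable X := - (2 * t)^-1%:C *: (N + acomp c c).
pose g (s : R) := (2 * t)^-1 * (t ^+ 2 + s ^+ 2).
pose c n := iter n f 0; pose d n := iter n g 0.
have t20 : 0 < 2 * t by rewrite mulr_gt0.
have i0 : 0 < (2 * t)^-1 by rewrite invr_gt0.
have tn0 : t != 0 by rewrite gt_eqF.
have d0 n : 0 <= d n.
  by elim: n => //= n _; rewrite mulr_ge0 ?addr_ge0 ?sqr_ge0 // ltW.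
have dt n : d n <= t.
  elim: n => /= [|n IH]; first exact: ltW.
  rewrite /g mulrC ler_pdivrMr //; have := d0 n; rewrite -/(d n); nra.
have gS s : g s - s = (2 * t)^-1 * (t - s) ^+ 2.
  by rewrite /g; field.
have dS n : d n <= d n.+1.
  by rewrite -subr_ge0 /= gS mulr_ge0 ?sqr_ge0 // ltW.
have fle (a : adjointable X) :
    rnorm (- (2 * t)^-1%:C *: a) = (2 * t)^-1 * rnorm a.
  by rewrite scaleNr rnormN rnormZR gtr0_norm.
have cd n : rnorm (c n) <= d n.
  elim: n => /= [|n IH]; first by rewrite rnorm0.
  rewrite fle ler_pM2l // (le_trans (rnormD _ _)) // lerD //.
  rewrite (le_trans (acomp_rnorm _ _)) // expr2.
  by rewrite ler_pM ?rnorm_ge0.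
have fB a b : f a - f b =
    - (2 * t)^-1%:C *: (acomp (a - b) a + acomp b (a - b)).
  rewrite /f -scalerBr opprD addrACA subrr add0r; congr (_ *: _).
  apply: adjointable_eq => x.
  change (a (a x) - b (b x) = a (a x) - b (a x) + b (a x - b x)).
  by rewrite linearB /= addrA subrK.
(* [c n.+2 - c n.+1] is a multiple of
   [(c n.+1 - c n) c n.+1 + c n (c n.+1 - c n)], and [d] satisfies the same
   identity with the same factor. *)
have cdS n : rnorm (c n.+1 - c n) <= d n.+1 - d n.
  elim: n => [|n IH].
    rewrite /= subr0 (_ : 0 = d 0%N) // subr0; exact: cd 1%N.
  rewrite (_ : c n.+2 = f (c n.+1)) // {2}(_ : c n.+1 = f (c n)) // fB fle.
  rewrite (_ : d n.+2 = g (d n.+1)) // {2}(_ : d n.+1 = g (d n)) //.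
  rewrite (_ : g _ - g _ =
      (2 * t)^-1 * ((d n.+1 - d n) * d n.+1 + d n * (d n.+1 - d n))).
    rewrite ler_pM2l // (le_trans (rnormD _ _)) // lerD //.
      by rewrite (le_trans (acomp_rnorm _ _)) // ler_pM ?rnorm_ge0.
    by rewrite (le_trans (acomp_rnorm _ _)) // ler_pM ?rnorm_ge0.
  by rewrite /g; field.
have cdD m n : rnorm (c (m + n)%N - c n) <= d (m + n)%N - d n.
  elim: m => [|m IH]; first by rewrite !subrr rnorm0.
  have := rnormD (c (m.+1 + n)%N - c (m + n)%N) (c (m + n)%N - c n).
  rewrite subrKA addSn; have := cdS (m + n)%N.
  move: (rnorm (c _ - c n)) (rnorm (c _ - c _)) (rnorm (c _ - c _)) IH => p q r.
  move: (d _) (d _) (d _) => x y z; lra.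
have cC (m n : nat) : rnorm (c m - c n) <= `|d m - d n|.
  case/orP: (leq_total n m) => [nm|mn].
    by rewrite (le_trans _ (ler_norm _)) // -(subnK nm).
  by rewrite rnormB distrC (le_trans _ (ler_norm _)) // -(subnK mn).
have [|C CP] := @adjointable_complete R A X c.
  move=> e /(nondecreasing_bounded_cauchy dS dt)[M MP].
  by exists M => m n Mm Mn; rewrite (le_lt_trans (cC _ _)) // MP.
have {}CP (e : R) : 0 < e ->
    exists n, rnorm (C - c n) <= e /\ rnorm (C - c n.+1) <= e.
  by move=> /CP[n nP]; exists n; split; apply: nP.
have Ct : rnorm C <= t.
  apply/ler_addgt0Pl => e /CP[n [nP _]].
  have := rnormD (C - c n) (c n); rewrite subrK; have := cd n; have := dt n; lra.
have cA n : madj (c n) = c n.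
  apply/self_adjointP; elim: n => [|n IH] x y.
    change (minner (0 : X) y = minner x 0).
    by rewrite -(scale0r (0 : X)) minnerZl minnerZr rmorph0 !scale0r.
  change (minner (- (2 * t)^-1%:C *: (N x + c n (c n x))) y =
    minner x (- (2 * t)^-1%:C *: (N y + c n (c n y)))).
  rewrite minnerZl minnerZr minnerDl minnerDr conj_Creal; last first.
    by rewrite rpredN complex_real.
  by rewrite !IH (proj1 (self_adjointP N) NN).
have CA : madj C = C.
  apply/eqP; rewrite -subr_eq0; apply/eqP/rnorm_le_eq0 => e e0.
  have [n [nP _]] := CP (e / 5) (divr_gt0 e0 (ltr0Sn _ _)).
  have := rnormD (madj C - madj (c n)) (c n - C).
  rewrite {1}cA subrKA -madjB (rnormB (c n)); have := madj_rnorm (C - c n); lra.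
have small (M : R) : 0 <= M -> forall e : R, 0 < e ->
    exists2 e', 0 < e' & M * e' <= e.
  move=> M0 e e0; have M1 : 0 < M + 1 by rewrite ltr_wpDl.
  exists (e / (M + 1)); first by rewrite divr_gt0.
  by rewrite mulrCA ger_pMr // ler_pdivrMr // mul1r lerDl.
have eqn x : C (C x) + (2 * t)%:C *: C x + N x = 0.
  suff -> : C (C x) + (2 * t)%:C *: C x + N x =
    (acomp C C + (2 * t)%:C *: C + N) x.
    have -> // : acomp C C + (2 * t)%:C *: C + N = 0.
    apply: rnorm_le_eq0 => e e0.
    have [|e' e'0 e'e] := small (4 * t) _ e e0; first by rewrite mulr_ge0 ?ltW.
    have [n [h1 h2]] := CP e' e'0.
    have -> : acomp C C + (2 * t)%:C *: C + N =
        (2 * t)%:C *: (C - c n.+1) + (acomp (C - c n) C + acomp (c n) (C - c n)).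
      rewrite scalerBr (_ : c n.+1 = f (c n)) // scalerA mulrN -rmorphM.
      rewrite mulfV ?gt_eqF // scaleN1r opprK.
      apply: adjointable_eq => y.
      change (C (C y) + (2 * t)%:C *: C y + N y =
        (2 * t)%:C *: C y + (N y + c n (c n y)) +
        (C (C y) - c n (C y) + c n (C y - c n y))).
      rewrite linearB /= subrKA [_ + (N y + _)]addrA [X in _ = _ + X]addrC.
      by rewrite addrA addrK [RHS]addrC addrA.
    have := rnormD ((2 * t)%:C *: (C - c n.+1))
      (acomp (C - c n) C + acomp (c n) (C - c n)).
    have := rnormD (acomp (C - c n) C) (acomp (c n) (C - c n)).
    have := acomp_rnorm (C - c n) C; have := acomp_rnorm (c n) (C - c n).
    have := cd n; have := dt n; rewrite rnormZR gtr0_norm //.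
    have := rnorm_ge0 (C - c n); have := rnorm_ge0 C; have := rnorm_ge0 (c n).
    nra.
  by [].
pose K := C + t%:C *: adjointable_id X.
have KE x : K x = C x + t%:C *: x by [].
exists K; split.
- apply/self_adjointP => x y; rewrite !KE minnerDl minnerDr minnerZl minnerZr.
  by rewrite conj_Creal ?complex_real // (proj1 (self_adjointP C) CA).
- move=> x; rewrite !KE linearD linearZ /= scalerDr scalerA -rmorphM -expr2.
  have /eqP := eqn x; rewrite addr_eq0 => /eqP E.
  rewrite -E [LHS]addrA [LHS]addrC; congr (_ + _).
  rewrite -addrA -scalerDl; congr (_ + _ *: _).
  by rewrite -rmorphD; congr (_%:C); ring.
- by rewrite /K addrK.
move=> S SN x.
have SC : acomp S C - acomp C S = 0.
  apply: rnorm_le_eq0 => e e0.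
  have [|e' e'0 e'e] := small (2 * rnorm S) _ e e0.
    by rewrite mulr_ge0 ?rnorm_ge0.
  have [n [h1 _]] := CP e' e'0.
  have Sc y : S (c n y) = c n (S y).
    elim: n {h1} y => [|n IH] y; first exact: linear0.
    rewrite /= /f; change (S (- (2 * t)^-1%:C *: (N y + c n (c n y))) =
      - (2 * t)^-1%:C *: (N (S y) + c n (c n (S y)))).
    by rewrite linearZ linearD /= SN !IH.
  have -> : acomp S C - acomp C S = acomp S (C - c n) - acomp (C - c n) S.
    apply: adjointable_eq => y.
    change (S (C y) - C (S y) = S (C y - c n y) - (C (S y) - c n (S y))).
    by rewrite linearB /= Sc opprB addrA subrK.
  have := rnormD (acomp S (C - c n)) (- acomp (C - c n) S); rewrite rnormN.
  have := acomp_rnorm S (C - c n); have := acomp_rnorm (C - c n) S.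
  have := rnorm_ge0 S; nra.
rewrite !KE linearD linearZ /=; congr (_ + _); apply/eqP; rewrite -subr_eq0.
by apply/eqP; exact: (congr1 (fun T : adjointable X => T x) SC).
Qed.

End SquareRoot.

(** * Operators on the Hilbert space induced by adjointable operators *)

Section Extension.
Variables (R : realType).
Variables (V : normedModType R[i]) (W : completeNormedModType R[i]).

(** The relation [G] is the graph of a bounded operator with a dense domain; the
    extension is the closure of that graph.  Starting from a relation dispenses
    with proving first that the operator is well defined. *)
Lemma dense_relation_extension (G : V -> W -> Prop) (M : R) : 0 <= M ->
  (forall k v w v' w', G v w -> G v' w' -> G (k *: v + v') (k *: w + w')) ->
  (forall v w, G v w -> rnorm w <= M * rnorm v) ->
  (forall v (e : R), 0 < e -> exists v' w', G v' w' /\ rnorm (v - v') < e) ->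
  exists b : bounded_op V W, rnorm b <= M /\ forall v w, G v w -> b v = w.
Proof.
move=> M0 GD GM Gd.
pose Gc v w := forall e : R, 0 < e ->
  exists v' w', [/\ G v' w', rnorm (v - v') < e & rnorm (w - w') < e].
have sub v w : G v w -> Gc v w.
  by move=> Gvw e e0; exists v, w; rewrite !subrr !rnorm0.
have GcD k v w v' w' : Gc v w -> Gc v' w' -> Gc (k *: v + v') (k *: w + w').
  move=> vw vw' e /(rnorm_lin_near k)[d d0 dP].
  have [u [z [Gu uv zw]]] := vw _ d0; have [u' [z' [Gu' uv' zw']]] := vw' _ d0.
  by exists (k *: u + u'), (k *: z + z'); split; [exact: GD|exact: dP|exact: dP].
have GcM v w : Gc v w -> rnorm w <= M * rnorm v.
  move=> vw; apply/ler_addgt0Pl => e e0.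
  have c0 : 0 < M + 1 by rewrite ltr_wpDl.
  have [u [z [Gu uv zw]]] := vw _ (divr_gt0 e0 c0).
  have := GM _ _ Gu; have := rnormD (w - z) z; rewrite subrK.
  have := rnormD (u - v) v; rewrite subrK rnormB.
  have : e / (M + 1) * (M + 1) = e by rewrite divfK // gt_eqF.
  move: (e / (M + 1)) uv zw => e' uv zw; nra.
have GcT v : exists w, Gc v w.
  have /choice[u uP] (n : nat) : exists p : V * W,
      G p.1 p.2 /\ rnorm (v - p.1) < n.+1%:R^-1.
    have [|v' [w' vw]] := Gd v n.+1%:R^-1; first by rewrite invr_gt0.
    by exists (v', w').
  have [|z zP] := @rnorm_complete R W (fun n => (u n).2).
    move=> e e0; have c0 : 0 < 2 * M + 1 by rewrite ltr_wpDl // mulr_ge0.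
    have [N NP] := inv_succ_lt (divr_gt0 e0 c0); exists N => m n Nm Nn.
    have [Gm um] := uP m; have [Gn un] := uP n.
    have := GM _ _ (GD (-1) _ _ _ _ Gn Gm); rewrite !scaleN1r.
    rewrite [- (u n).2 + _]addrC [- (u n).1 + _]addrC.
    have := rnormD ((u m).1 - v) (v - (u n).1); rewrite subrKA (rnormB _ v).
    have := lt_trans um (NP m Nm); have := lt_trans un (NP n Nn).
    have : e / (2 * M + 1) * (2 * M + 1) = e by rewrite divfK // gt_eqF.
    move: (e / (2 * M + 1)) => e' ee' h1 h2 h3 h4.
    have : M * rnorm ((u m).1 - (u n).1) <= M * (2 * e').
      by rewrite ler_wpM2l //; lra.
    have : 0 < e' by have := rnorm_ge0 (v - (u m).1); lra.
    lra.
  exists z => e e0; have [N1 NP1] := inv_succ_lt e0; have [N2 NP2] := zP _ e0.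
  exists (u (maxn N1 N2)).1, (u (maxn N1 N2)).2.
  have [G1 G2] := uP (maxn N1 N2); split => //.
    by rewrite (lt_trans G2) // NP1 ?leq_maxl.
  by rewrite NP2 // leq_maxr.
have [b bP] := choice GcT.
have GcF v w w' : Gc v w -> Gc v w' -> w = w'.
  move=> vw vw'; have := GcM _ _ (GcD (-1) _ _ _ _ vw' vw).
  rewrite !scaleN1r addNr rnorm0 mulr0 => h.
  apply/eqP; rewrite -subr_eq0 addrC; apply/eqP/rnorm0_eq0/eqP.
  by rewrite eq_le h rnorm_ge0.
have bB : b \in @bounded_linear R V W.
  apply/bounded_linearP; split=> [k x y|]; last by exists M => // x; exact: GcM.
  by apply: (GcF _ _ _ (bP _)); exact: GcD.
exists (BoundedOp bB); split=> [|v w vw]; last exact: GcF (bP v) (sub _ _ vw).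
by apply: op_rnorm_le => // x; exact: GcM.
Qed.

End Extension.

Section InducedOperator.
Variables (R : realType) (A : cstarAlgType R) (X : hilbertModType A).
Variables (H0 H1 : hilbertType R).
Variables (rho : A -> bounded_op H0 H0) (pi : X -> bounded_op H0 H1).
Hypothesis pi_rep : hmod_representation rho pi.
Hypothesis pi_dense :
  dense (lspan [set pi x xi | x in [set: X] & xi in [set: H0]]).
Implicit Types (S T : adjointable X) (x y : X) (s u : seq (X * H0)).
Implicit Types (b c : bounded_op H1 H1).

(** A list of pairs [(x, xi)] stands for the vector sum of the [pi x xi]; these
    vectors form the dense span, scalars being absorbed in the [xi]. *)
Definition ev s : H1 := \sum_(p <- s) pi p.1 p.2.
Definition act (f : X -> X) s := [seq (f p.1, p.2) | p <- s].

Lemma pi_linear : linear pi.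
Proof. by case: pi_rep. Qed.

Lemma piD x y : pi (x + y) = pi x + pi y.
Proof. by have := pi_linear 1 x y; rewrite !scale1r. Qed.

Lemma pi0 : pi 0 = 0.
Proof. by apply: (addrI (pi 0)); rewrite -piD !addr0. Qed.

Lemma piZ k x : pi (k *: x) = k *: pi x.
Proof. by have := pi_linear k x 0; rewrite pi0 !addr0. Qed.

Lemma hdot_pi x y xi eta :
  hdot (pi x xi) (pi y eta) = hdot xi (rho (minner x y) eta).
Proof. by case: pi_rep => _ _ _ ->; rewrite adjP. Qed.

Lemma ev_cat s u : ev (s ++ u) = ev s + ev u.
Proof. by rewrite /ev big_cat. Qed.

Lemma ev_actD (f g : X -> X) s :
  ev (act (fun x => f x + g x) s) = ev (act f s) + ev (act g s).
Proof.
by rewrite /ev !big_map -big_split; apply: eq_bigr => p _ /=; rewrite piD.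
Qed.

Lemma ev_actZ k (f : X -> X) s : ev (act (fun x => k *: f x) s) =
  k *: ev (act f s).
Proof.
by rewrite /ev !big_map scaler_sumr; apply: eq_bigr => p _ /=; rewrite piZ.
Qed.

Lemma ev_act_ext (f g : X -> X) s : f =1 g -> ev (act f s) = ev (act g s).
Proof. by move=> fg; rewrite /ev !big_map; apply: eq_bigr => p _; rewrite fg. Qed.

Lemma act_comp (f g : X -> X) s : act f (act g s) = act (f \o g) s.
Proof. by rewrite /act -map_comp. Qed.

Lemma act_id s : act id s = s.
Proof. by rewrite /act -[RHS]map_id; apply: eq_map => -[]. Qed.

Lemma hdot_sumr (H : hilbertType R) (v : H) I (r : seq I) (F : I -> H) :
  hdot v (\sum_(i <- r) F i) = \sum_(i <- r) hdot v (F i).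
Proof.
elim: r => [|i r IH]; last by rewrite !big_cons hdotDr IH.
by rewrite !big_nil -(scale0r (0 : H)) hdotZr mul0r.
Qed.

Lemma hdot_suml (H : hilbertType R) (v : H) I (r : seq I) (F : I -> H) :
  hdot (\sum_(i <- r) F i) v = \sum_(i <- r) hdot (F i) v.
Proof.
rewrite -hdotC hdot_sumr rmorph_sum; apply: eq_bigr => i _.
exact: hdotC.
Qed.

(** The adjoint relation survives because [<pi x xi, pi y eta>] depends on
    [<x, y>] alone. *)
Lemma hdot_ev_act T s u :
  hdot (ev (act T s)) (ev u) = hdot (ev s) (ev (act (madj T) u)).
Proof.
rewrite /ev !big_map !hdot_suml; apply: eq_bigr => p _.
by rewrite !hdot_sumr; apply: eq_bigr => q _; rewrite /= !hdot_pi madjP.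
Qed.

(** With [K] the square root of [M^2 - T^* T], the difference
    [M^2 |ev s|^2 - |ev (act T s)|^2] equals [|ev (act K s)|^2], hence is
    nonnegative. *)
Lemma ev_act_bound T (M : R) s : 0 < M ->
  rnorm (acomp (madj T) T) <= M ^+ 2 ->
  rnorm (ev (act T s)) <= M * rnorm (ev s).
Proof.
move=> M0 TM.
have TT : madj (acomp (madj T) T) = acomp (madj T) T.
  by apply/self_adjointP => x y /=; rewrite -madjP madjPl.
have [K [KK K2 _ _]] := adjointable_sqrt M0 TT TM.
rewrite -ler_sqr ?nnegrE ?mulr_ge0 ?rnorm_ge0 ?(ltW M0) // exprMn -subr_ge0.
have -> : M ^+ 2 * rnorm (ev s) ^+ 2 - rnorm (ev (act T s)) ^+ 2 =
   rnorm (ev (act K s)) ^+ 2; last exact: sqr_ge0.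
rewrite -!hdotxx !hdot_ev_act !act_comp KK.
have -> : ev (act (K \o K) s) = (M ^+ 2)%:C *: ev s - ev (act (madj T \o T) s).
  apply/eqP; rewrite -subr_eq opprK -ev_actD -{2}(act_id s) -ev_actZ; apply/eqP.
  by apply: ev_act_ext => x /=; rewrite K2 subrK.
rewrite hdotDr hdotNr hdotZr /=.
move: (M ^+ 2) => m.
case: (hdot _ (ev s)) (hdot _ (ev (act _ s))) => [p q] [r z] /=.
by rewrite mul0r subr0.
Qed.

Lemma ev_dense v (e : R) : 0 < e -> exists s, rnorm (v - ev s) < e.
Proof.
move=> e0; have [_ [n [k [t [tP ->]]]] tv] := dense_rnormP v pi_dense e0.
have /choice[p pP] i : exists p : X * H0, k i *: t i = pi p.1 p.2.
  have [x _ [xi _ <-]] := tP i.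
  by exists (x, k i *: xi); rewrite /= linearZ.
exists [seq p i | i <- enum 'I_n].
by rewrite /ev big_map big_enum /= -(eq_bigr _ (fun i _ => pP i)).
Qed.

Lemma orth_pi_eq0 v : (forall x xi, hdot v (pi x xi) = 0) -> v = 0.
Proof.
move=> v0; apply: rnorm_le_eq0 => e e0.
have [s sP] := @ev_dense v (e / 4) (divr_gt0 e0 (ltr0Sn _ _)).
have vs : hdot v (ev s) = 0 by rewrite hdot_sumr big1 // => p _; exact: v0.
have := @rnorm_sqr_hdot_le R H1 H1 v v (v - ev s).
rewrite hdotDr hdotNr vs subr0 => /(_ erefl).
have := rnorm_ge0 v.
have [->|n0] := eqVneq (rnorm v) 0; first by move=> *; exact: ltW.
move=> vg0; have vp : 0 < rnorm v by rewrite lt_def n0.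
by rewrite expr2 -mulrA mulrCA ler_pM2l //; lra.
Qed.

(** By density the vectors [pi x xi] determine a bounded operator; passing to
    adjoints reduces this to [orth_pi_eq0]. *)
Lemma eq_on_pi b c : (forall x, bcomp b (pi x) = bcomp c (pi x)) -> b = c.
Proof.
move=> bc; apply: bounded_op_eq => v.
apply/eqP; rewrite -subr_eq0; apply/eqP/hdot_ext => w.
rewrite hdotDr hdotNr -!adjPl -hdotNl -hdotDl.
have -> : adj b w - adj c w = 0.
  apply: orth_pi_eq0 => x xi; rewrite hdotDl hdotNl !adjPl.
  have := congr1 (fun f : bounded_op H0 H1 => f xi) (bc x).
  by move=> /= ->; rewrite subrr.
by rewrite -(scale0r (0 : H1)) hdotZl hdotZr rmorph0 !mul0r.
Qed.

(** [sum pi x_i xi_i |-> sum pi (T x_i) xi_i] is bounded on a dense subspace by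
    [ev_act_bound]; the crude bound [M] is chosen to satisfy
    [|T^* T| <= M^2]. *)
Lemma induced_exists T : exists b : bounded_op H1 H1,
  forall x, bcomp b (pi x) = pi (T x).
Proof.
pose M := rnorm (acomp (madj T) T) + 1.
have M0 : 0 < M by rewrite ltr_wpDl ?rnorm_ge0.
have TM : rnorm (acomp (madj T) T) <= M ^+ 2.
  by rewrite /M; have := rnorm_ge0 (acomp (madj T) T); nra.
have [| | |b [_ bP]] := @dense_relation_extension R H1 H1
    (fun v w => exists s, v = ev s /\ w = ev (act T s)) M (ltW M0).
- move=> k _ _ _ _ [s [-> ->]] [u [-> ->]].
  exists ([seq (k *: p.1, p.2) | p <- s] ++ u).
  rewrite /act map_cat !ev_cat -!/(act _ _).
  split; congr (_ + _); rewrite /ev !big_map scaler_sumr; apply: eq_bigr => p _.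
    by rewrite piZ.
  by rewrite /= linearZ piZ.
- by move=> _ _ [s [-> ->]]; exact: ev_act_bound.
- move=> v e /(ev_dense v)[s sv]; exists (ev s), (ev (act T s)).
  by split=> //; exists s.
exists b => x; apply: bounded_op_eq => xi /=.
by apply: bP; exists [:: (x, xi)]; rewrite /ev !big_seq1.
Qed.

Definition induced_op T : bounded_op H1 H1 := sval (cid (induced_exists T)).

Lemma inducedP T x : bcomp (induced_op T) (pi x) = pi (T x).
Proof. exact: svalP (cid (induced_exists T)) x. Qed.

Lemma inducedE T x xi : induced_op T (pi x xi) = pi (T x) xi.
Proof. by have := congr1 (fun f : bounded_op H0 H1 => f xi) (inducedP T x). Qed.

Lemma induced_unique T b : (forall x, bcomp b (pi x) = pi (T x)) ->
  b = induced_op T.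
Proof. by move=> bT; apply: eq_on_pi => x; rewrite bT inducedP. Qed.

Lemma induced_lin k S T : induced_op (k *: S + T) =
  k *: induced_op S + induced_op T.
Proof.
apply/esym/induced_unique => x; apply: bounded_op_eq => xi.
change (k *: induced_op S (pi x xi) + induced_op T (pi x xi) =
  pi (k *: S x + T x) xi).
by rewrite piD piZ !inducedE.
Qed.

Lemma induced_comp S T : induced_op (acomp S T) =
  bcomp (induced_op S) (induced_op T).
Proof.
apply/esym/induced_unique => x; apply: bounded_op_eq => xi /=.
by rewrite !inducedE.
Qed.

Lemma induced_id v : induced_op (adjointable_id X) v = v.
Proof.
have I : idfun \in @bounded_linear R H1 H1.
  by apply/bounded_linearP; split=> //; exists 1 => // x; rewrite mul1r.
suff <- : BoundedOp I = induced_op (adjointable_id X) by [].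
by apply: induced_unique => x; exact: bounded_op_eq.
Qed.

Lemma induced_adj T : induced_op (madj T) = adj (induced_op T).
Proof.
apply/esym/induced_unique => x; apply: bounded_op_eq => xi /=.
apply/eqP; rewrite -subr_eq0; apply/eqP/orth_pi_eq0 => y eta.
by rewrite hdotDl hdotNl adjPl inducedE !hdot_pi madjPl subrr.
Qed.

Lemma induced_inj : injective pi -> injective induced_op.
Proof.
move=> pi_inj S T ST; apply: adjointable_eq => x; apply: pi_inj.
by rewrite -!inducedP ST.
Qed.

Lemma ev_act_induced T s : ev (act T s) = induced_op T (ev s).
Proof.
rewrite /ev big_map linear_sum; apply: eq_bigr => p _ /=; by rewrite inducedE.
Qed.

Lemma induced_bound T (M : R) : 0 < M ->
  rnorm (acomp (madj T) T) <= M ^+ 2 -> rnorm (induced_op T) <= M.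
Proof.
move=> M0 TM; apply: op_rnorm_le => [|v]; first exact: ltW.
apply/ler_addgt0Pl => e e0.
have c0 : 0 < rnorm (induced_op T) + M by rewrite ltr_wpDl ?rnorm_ge0.
have [s sv] := ev_dense v (divr_gt0 e0 c0).
have := ev_act_bound s M0 TM; rewrite ev_act_induced.
have := op_rnorm_ub (induced_op T) (v - ev s); rewrite linearB.
have := rnormD (induced_op T v - induced_op T (ev s)) (induced_op T (ev s)).
rewrite subrK.
have := rnormD (ev s - v) v; rewrite subrK (rnormB _ v).
have := divfK (lt0r_neq0 c0) e.
move: (e / _) sv => e' sv; have := rnorm_ge0 (induced_op T); nra.
Qed.

End InducedOperator.

(** * Transport of star-subalgebras *)

Section StarIso.
Variables (R : realType) (A B : starAlgType R) (f : A -> B).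
Hypotheses (f_hom : star_hom f) (f_inj : injective f).

Lemma star_hom0 : f 0 = 0.
Proof.
case: f_hom => fL _ _; have := fL (-1) 0 0.
by rewrite scaler0 addr0 scaleN1r addNr.
Qed.

Lemma star_subalgebra_image (D : set A) :
  star_subalgebra D -> star_subalgebra (f @` D).
Proof.
case: f_hom => fL fM fS [D0 DL DM DS]; split.
- by exists 0; [exact: D0|exact: star_hom0].
- by move=> k _ _ [a Da <-] [b Db <-]; exists (k *: a + b); [exact: DL|exact: fL].
- by move=> _ _ [a Da <-] [b Db <-]; exists (smul a b); [exact: DM|exact: fM].
- by move=> _ [a Da <-]; exists (star a); [exact: DS|exact: fS].
Qed.

Lemma star_iso_image (D : set A) : star_subalgebra D -> star_iso D (f @` D) f.
Proof.
move=> DA; case: f_hom => fL fM fS; split=> //.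
- exact: star_subalgebra_image.
- by apply: inj_bij => a b _ _; exact: f_inj.
by split=> *; [exact: fL|exact: fM|exact: fS].
Qed.

Lemma star_iso_inverse (D : set A) (g : B -> A) : star_subalgebra D ->
  (forall a, g (f a) = a) -> star_iso (f @` D) D g.
Proof.
move=> DA fK; case: f_hom => fL fM fS; split=> //.
- exact: star_subalgebra_image.
- split.
  + by move=> _ [a Da <-] /=; rewrite fK.
  + by move=> _ _ /set_mem[a _ <-] /set_mem[b _ <-]; rewrite !fK => ->.
  + by move=> a Da /=; exists (f a); [exists a|exact: fK].
split.
- by move=> k _ _ [a _ <-] [b _ <-]; rewrite -fL !fK.
- by move=> _ _ [a _ <-] [b _ <-]; rewrite -fM !fK.
- by move=> _ [a _ <-]; rewrite -fS !fK.
Qed.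

End StarIso.

(** * The compact operators *)

Section Compacts.
Variables (R : realType) (A : cstarAlgType R) (X : hilbertModType A).
Implicit Types (S T : adjointable X).

Lemma acomp_theta T (x y : X) : acomp T (theta x y) = theta (T x) y.
Proof. by apply: adjointable_eq => z /=; rewrite adjointable_mact. Qed.

Lemma madj_theta (x y : X) : madj (theta x y) = theta y x.
Proof.
by apply: madj_unique => z w /=; rewrite minnerMl minnerMr minnerC.
Qed.

Lemma compacts_star_subalgebra : star_subalgebra (@compacts R A X).
Proof.
have starL k S T : star (k *: S + T) =
    (k^*)%R *: star S + star T :> adjointable X.
  by rewrite starD starZ.
split.
- exact/subset_closure/lspan0.
- by apply: closure_lin_closed; exact: lspan_lin.
- move=> S T _; apply: (@closure_lipschitz R _ _ _ _ _ (rnorm S)).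
  + exact: rnorm_ge0.
  + move=> a b; rewrite (_ : _ - _ = acomp S (a - b)) ?acomp_rnorm //.
    apply: adjointable_eq => x; change (S (a x) - S (b x) = S (a x - b x)).
    by rewrite linearB.
  + apply: (@lspan_min _ _ _ (fun T => lspan _ (smul S T))).
    * rewrite (_ : smul S 0 = 0); first exact: lspan0.
      by apply: adjointable_eq => x; exact: linear0.
    * by move=> k a b Sa Sb; rewrite smulDr smulZr; exact: lspan_lin.
    move=> _ [x _ [y _ <-]]; apply: lspan_mem.
    by exists (S x) => //; exists y => //; rewrite -acomp_theta.
- move=> T; apply: (@closure_lipschitz R _ _ _ _ _ 4) => //.
  + by move=> a b; rewrite -[_ - _]madjB madj_rnorm.
  apply: (@lspan_min _ _ _ (fun T => lspan _ (star T))).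
  * rewrite (_ : star 0 = 0); first exact: lspan0.
    by have := madjB (0 : adjointable X) 0; rewrite !subrr.
  * by move=> k a b Sa Sb; rewrite starL; exact: lspan_lin.
  move=> _ [x _ [y _ <-]]; apply: lspan_mem.
  by exists y => //; exists x => //; rewrite -madj_theta.
Qed.

End Compacts.

(** * Induction is isometric on self-adjoint operators *)

Section Isometry.
Variables (R : realType) (A : cstarAlgType R) (X : hilbertModType A).
Variables (H0 H1 : hilbertType R).
Variables (rho : A -> bounded_op H0 H0) (pi : X -> bounded_op H0 H1).
Hypothesis pi_rep : hmod_representation rho pi.
Hypothesis pi_dense :
  dense (lspan [set pi x xi | x in [set: X] & xi in [set: H0]]).
Hypothesis pi_inj : injective pi.
Implicit Types (S T : adjointable X) (x y : X) (v w : H1).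

Let Phi := induced_op pi_rep pi_dense.

Lemma inducedB S T : Phi (S - T) = Phi S - Phi T.
Proof.
have -> : S - T = -1 *: T + S by rewrite scaleN1r addrC.
by rewrite /Phi induced_lin scaleN1r addrC.
Qed.

Lemma inducedZ k T : Phi (k *: T) = k *: Phi T.
Proof.
have P0 : Phi 0 = 0 by have := inducedB 0 0; rewrite !subrr.
by rewrite -[k *: T]addr0 /Phi induced_lin -/Phi P0 addr0.
Qed.

Lemma induced_shift T (r : R) v :
  Phi (r%:C *: adjointable_id X - T) v = r%:C *: v - Phi T v.
Proof.
rewrite inducedB inducedZ.
by change (r%:C *: Phi (adjointable_id X) v - Phi T v = r%:C *: v - Phi T v);
  rewrite /Phi induced_id.
Qed.

Lemma self_adjoint_shift T (r : R) :
  madj T = T -> madj (r%:C *: adjointable_id X - T) =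
  r%:C *: adjointable_id X - T.
Proof.
move=> /self_adjointP TT; apply/self_adjointP => x y.
change (minner (r%:C *: x - T x) y = minner x (r%:C *: y - T y)).
rewrite minnerBl minnerBr minnerZl minnerZr TT conj_Creal //.
by rewrite complex_real.
Qed.

Lemma self_adjoint_sqr T : madj T = T -> madj (acomp T T) = acomp T T.
Proof.
by move=> /self_adjointP TT; apply/self_adjointP => x y /=; rewrite !TT.
Qed.

(** Let [Z = s^2 - T^2].  Its image is bounded below by
    [s^2 - |induced_op T|^2 > 0].  Inside the module algebra, two square roots
    produce [m], the absolute value of [Z]: [k = (t^2 - Z^2)^(1/2)] and
    [m = (t^2 - k^2)^(1/2)], so that [m^2 = Z^2].  On the Hilbert space a
    nonnegative operator and a strictly positive one that commute and have equal
    squares coincide; thus [m] and [Z] have the same image, and injectivity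
    gives [m = Z].  Hence [Z] has a square root [h], and [T^2 + h^2 = s^2]
    bounds the norm of [T] by [rnorm_le_of_sqr_sum]. *)
Lemma induced_isometric T (s : R) :
  madj T = T -> rnorm (Phi T) < s -> rnorm T <= s.
Proof.
move=> TT Ts; have s0 : 0 < s by rewrite (le_lt_trans _ Ts) ?rnorm_ge0.
pose Z : adjointable X := (s ^+ 2)%:C *: adjointable_id X - acomp T T.
have ZZ : madj Z = Z by apply/self_adjoint_shift/self_adjoint_sqr.
pose tau := rnorm Z + 1; pose t := tau ^+ 2.
have tau0 : 0 < tau by rewrite ltr_wpDl ?rnorm_ge0.
have t0 : 0 < t by rewrite exprn_gt0.
have Zt : rnorm Z <= t by rewrite /t /tau; have := rnorm_ge0 Z; nra.
have tE : t = tau ^+ 2 by [].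
clearbody t.
have sqr_le S : rnorm S <= t -> rnorm (acomp S S) <= t ^+ 2.
  move=> St; rewrite (le_trans (acomp_rnorm _ _)) // expr2.
  by rewrite ler_pM ?rnorm_ge0.
(* [t] is any positive square that bounds [|Z|]: being [tau^2], it also serves
   as the square of the parameter in the extraction of [h]. *)
have [k [kk k2 _ kC]] := adjointable_sqrt t0 (self_adjoint_sqr ZZ) (sqr_le _ Zt).
have kZ x : Z (k x) = k (Z x) by exact: kC.
have kt : rnorm k <= t.
  apply: (rnorm_le_of_sqr_sum kk ZZ (ltW t0)) => x; last by rewrite k2 subrK.
  by rewrite kZ.
have [m [mm m2 mt mC]] := adjointable_sqrt t0 (self_adjoint_sqr kk) (sqr_le _ kt).
have m2Z : acomp m m = acomp Z Z.
  by apply: adjointable_eq => x; rewrite /= m2 /= k2 subKr.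
have mZ : acomp m Z = acomp Z m.
  apply: adjointable_eq => x; apply/esym/mC => y.
  by change (Z (k (k y)) = k (k (Z y))); rewrite !kZ.
(* [|m - t| <= t] gives [|Phi m w - t w| <= t |w|]; expand the square. *)
have Phi_m_ge0 w : 0 <= complex.Re (hdot (Phi m w) w).
  have : rnorm (t%:C *: w - Phi m w) ^+ 2 <= (t * rnorm w) ^+ 2.
    rewrite ler_sqr ?nnegrE ?mulr_ge0 ?rnorm_ge0 ?(ltW t0) //.
    rewrite -induced_shift (le_trans (op_rnorm_ub _ _)) //.
    rewrite ler_wpM2r ?rnorm_ge0 //; apply: induced_bound => //.
    by rewrite self_adjoint_shift //; apply: sqr_le; rewrite rnormB.
  rewrite rnormB -scaleNr -rmorphN rnorm_sqrD exprMn sqrrN => h.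
  by have := sqr_ge0 (rnorm (Phi m w)); nra.
have Phi_Z_ge w :
    (s ^+ 2 - rnorm (Phi T) ^+ 2) * rnorm w ^+ 2 <= complex.Re (hdot (Phi Z w) w).
  rewrite induced_shift /Phi induced_comp hdotDl hdotNl hdotZl /= adjP.
  rewrite -induced_adj TT conj_Creal ?complex_real // raddfB /= -/Phi hdotxx.
  have -> : complex.Re ((s ^+ 2)%:C * hdot w w) = s ^+ 2 * rnorm w ^+ 2.
    by rewrite -hdotxx; case: (hdot w w) => p q /=; rewrite mul0r subr0.
  rewrite mulrBl lerD2l lerN2 -exprMn ler_sqr ?nnegrE ?mulr_ge0 ?rnorm_ge0 //.
  exact: op_rnorm_ub.
(* [w = (m - Z) v] is killed by [m + Z], while [Re <(m + Z) w, w>] is at least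
   a positive multiple of [|w|^2]. *)
have mE : m = Z.
  have Phi_inj : injective Phi := induced_inj pi_inj.
  apply: Phi_inj; apply: bounded_op_eq => v.
  apply/eqP; rewrite -subr_eq0; apply/eqP.
  set w := _ - _; apply: rnorm0_eq0.
  have w0 : Phi m w + Phi Z w = 0.
    have PC S S' u : Phi S (Phi S' u) = Phi (acomp S S') u.
      by rewrite /Phi induced_comp.
    by rewrite /w !linearB /= !PC m2Z mZ addrA subrK subrr.
  have : complex.Re (hdot (Phi m w + Phi Z w) w) = 0.
    by rewrite w0 -(scale0r (0 : H1)) hdotZl rmorph0 mul0r.
  rewrite hdotDl raddfD /=.
  have := Phi_m_ge0 w; have := Phi_Z_ge w.
  have : rnorm (Phi T) ^+ 2 < s ^+ 2.
    by rewrite ltr_sqr ?nnegrE ?rnorm_ge0 // ltW.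
  have := sqr_ge0 (rnorm w) => h1 h2 h3 h4 h5; apply/eqP.
  by rewrite -sqrf_eq0 eq_le h1 andbT; nra.
(* [|Z - t| = |m - t| <= tau^2], so [Z = tau^2 - (t - Z)] has a root. *)
have [|h [hh h2 _ hC]] := adjointable_sqrt tau0 (self_adjoint_shift t ZZ).
  by rewrite rnormB -tE -mE.
apply: (rnorm_le_of_sqr_sum TT hh (ltW s0)) => x.
  apply: hC => y.
  change (T (t%:C *: y - ((s ^+ 2)%:C *: y - T (T y))) =
    t%:C *: T y - ((s ^+ 2)%:C *: T y - T (T (T y)))).
  by rewrite !linearB !linearZ.
rewrite h2 -tE.
change (T (T x) + (t%:C *: x - (t%:C *: x - ((s ^+ 2)%:C *: x - T (T x)))) =
  (s ^+ 2)%:C *: x).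
by rewrite subKr addrC subrK.
Qed.

(** Only self-adjoint operators are covered by [induced_isometric], so [T^* T]
    is compared with its image.  The constant is the square root of 16: one
    factor 4 comes from [rnorm_sqr_madj], the other from [adj_rnorm]. *)
Lemma induced_bounded_below T : rnorm T <= 4 * rnorm (Phi T).
Proof.
have h : rnorm (acomp (madj T) T) <= 4 * rnorm (Phi T) ^+ 2.
  apply/ler_addgt0Pl => e e0; apply: induced_isometric.
    by apply/self_adjointP => x y /=; rewrite -madjP madjPl.
  rewrite /Phi induced_comp induced_adj -/Phi.
  have := bcomp_rnorm (adj (Phi T)) (Phi T); have := adj_rnorm (Phi T).
  have := rnorm_ge0 (Phi T); nra.
rewrite -ler_sqr ?nnegrE ?mulr_ge0 ?rnorm_ge0 //.
by rewrite (le_trans (rnorm_sqr_madj T)) // exprMn; lra.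
Qed.

Lemma induced_bounded T : rnorm (Phi T) <= 2 * rnorm T.
Proof.
apply/ler_addgt0Pl => e e0; apply: induced_bound.
  by rewrite ltr_wpDr ?mulr_ge0 ?rnorm_ge0.
have := acomp_rnorm (madj T) T; have := madj_rnorm T; have := rnorm_ge0 T.
by nra.
Qed.

Lemma induced_star_hom : star_hom (Phi : adjointable X -> bounded_op H1 H1).
Proof.
split; [exact: induced_lin|exact: induced_comp|exact: induced_adj].
Qed.

Lemma induced_theta x y : Phi (theta x y) = bcomp (pi x) (adj (pi y)).
Proof.
apply/esym/induced_unique => z; apply: bounded_op_eq => xi.
by case: pi_rep => _ _ /= -> /= piI; rewrite piI.
Qed.

(** The spans of the generators correspond to each other, and boundedness of
    [induced_op] gives one inclusion between the closures.  For the other,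
    approximants of [b] lift to a Cauchy sequence by [induced_bounded_below],
    and it converges because the algebra of adjointable operators is
    complete. *)
Lemma induced_compacts :
  Phi @` (compacts X) = closure (lspan [set bcomp (pi x) (adj (pi y)) |
                                       x in [set: X] & y in [set: X]]).
Proof.
set E := lspan _; have [PL _ _] := induced_star_hom.
have spanE : Phi @` (lspan [set theta x y | x in [set: X] & y in [set: X]]) = E.
  apply/seteqP; split.
    move=> _ [T + <-]; move: T; apply: lspan_min => [|k S T ES ET|].
    - by rewrite (star_hom0 induced_star_hom); exact: lspan0.
    - by rewrite PL; exact: lspan_lin.
    move=> _ [x _ [y _ <-]]; rewrite induced_theta; apply: lspan_mem.
    by exists x => //; exists y.
  apply: lspan_min => [|k _ _ [S sS <-] [T sT <-]|].
  - by exists 0; [exact: lspan0|exact: (star_hom0 induced_star_hom)].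
  - by exists (k *: S + T); [exact: lspan_lin|exact: PL].
  move=> _ [x _ [y _ <-]]; exists (theta x y); last exact: induced_theta.
  by apply: lspan_mem; exists x => //; exists y.
apply/seteqP; split=> [_ [T KT <-]|b /closure_rnormP Eb].
  move: KT; apply: (@closure_lipschitz R _ _ _ _ Phi 2) => // [S S'|S sS].
    by rewrite -inducedB induced_bounded.
  by rewrite -spanE; exists S.
have /choice[u uP] (n : nat) : exists T : adjointable X,
    lspan [set theta x y | x in [set: X] & y in [set: X]] T /\
    rnorm (b - Phi T) < n.+1%:R^-1.
  have [|c + bc] := Eb n.+1%:R^-1; first by rewrite invr_gt0.
  by rewrite -spanE => -[T sT Tc]; exists T; rewrite Tc.
have [|T TP] := @adjointable_complete R A X u.
  move=> e e0; have [N NP] := inv_succ_lt (e := e / 8) (divr_gt0 e0 (ltr0Sn _ _)).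
  exists N => m n Nm Nn.
  have := induced_bounded_below (u m - u n); rewrite inducedB.
  have := rnormD (Phi (u m) - b) (b - Phi (u n)); rewrite subrKA (rnormB _ b).
  have [_ um] := uP m; have [_ un] := uP n.
  have := lt_trans um (NP m Nm); have := lt_trans un (NP n Nn).
  move: (rnorm (u m - u n)) (rnorm (Phi (u m) - Phi (u n))) => p q.
  move: (rnorm (b - Phi (u m))) (rnorm (b - Phi (u n))) => p' q'. lra.
exists T.
  apply/closure_rnormP => e e0.
  have [N NP] := TP (e / 2) (divr_gt0 e0 (ltr0Sn _ _)).
  exists (u N); first by have [] := uP N.
  by have := NP N (leqnn N); lra.
apply/eqP; rewrite -subr_eq0; apply/eqP/rnorm_le_eq0 => e e0.
have [N NP] := TP (e / 4) (divr_gt0 e0 (ltr0Sn _ _)).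
have [M MP] := inv_succ_lt (e := e / 2) (divr_gt0 e0 (ltr0Sn _ _)).
have := NP _ (leq_maxl N M); have := MP _ (leq_maxr N M).
have [_] := uP (maxn N M); move: (maxn N M) => n h1 h2 h3.
have := rnormD (Phi T - Phi (u n)) (Phi (u n) - b).
rewrite subrKA (rnormB (Phi (u n))).
rewrite -inducedB; have := induced_bounded (T - u n) => h4 h5.
rewrite (le_trans h5) // [leRHS](splitr e) lerD //; last first.
  exact: ltW (lt_trans h1 h2).
by rewrite (le_trans h4) // -ler_pdivlMl // (le_trans h3) //; lra.
Qed.

(** If [b pi x] and [b^* pi x] remain in the range of [pi], the two maps of the
    module that they define are adjoint to each other: apply the injective [rho]
    to the inner products.  The operator induced by the first map is [b] by
    density. *)
Lemma range_induced : injective rho ->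
  [set b : bounded_op H1 H1 | forall x, range pi (bcomp b (pi x)) /\
                                        range pi (bcomp (adj b) (pi x))] =
  Phi @` [set: adjointable X].
Proof.
move=> rho_inj; apply/seteqP; split=> [b bB|_ [T _ <-] x]; last first.
  rewrite -induced_adj !inducedP; split; first by exists (T x).
  by exists (madj T x).
have /choice[f fP] x : exists y, pi y = bcomp b (pi x).
  by have [[y _ <-] _] := bB x; exists y.
have /choice[g gP] x : exists y, pi y = bcomp (adj b) (pi x).
  by have [_ [y _ <-]] := bB x; exists y.
have fA : f \in @has_adjoint R A X.
  apply/asboolP; exists g => x y; apply: rho_inj; apply: bounded_op_eq => xi.
  apply: hdot_ext => eta; rewrite -!(hdot_pi pi_rep) fP gP /=.
  exact: adjP.
exists (Adjointable fA) => //; apply/esym/induced_unique => x.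
by rewrite -fP.
Qed.

End Isometry.

Local Close Scope complex_scope.

Theorem proposition3p10 (R : realType) (A : cstarAlgType R)
    (X : hilbertModType A) (H0 H1 : hilbertType R)
    (rho : A -> bounded_op H0 H0) (pi : X -> bounded_op H0 H1) :
  hmod_representation rho pi ->
  injective rho ->
  dense (lspan [set pi x xi | x in [set: X] & xi in [set: H0]]) ->
  (exists Phi : adjointable X -> bounded_op H1 H1,
     star_iso (compacts X)
       (closure (lspan [set bcomp (pi x) (adj (pi y)) |
                          x in [set: X] & y in [set: X]])) Phi /\
     forall x y, Phi (theta x y) = bcomp (pi x) (adj (pi y))) /\
  (let B := [set b : bounded_op H1 H1 |
               forall x, range pi (bcomp b (pi x)) /\
                         range pi (bcomp (adj b) (pi x))] in
   let tau (b : bounded_op H1 H1) (t : bounded_op H0 H1) := bcomp b t in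
   (forall b, B b -> set_fun (range pi) (range pi) (tau b)) /\
   exists Psi : bounded_op H1 H1 -> adjointable X,
     (forall b, B b ->
        Psi b = pinv [set: X] pi \o tau b \o pi :> (X -> X)) /\
     star_iso B [set: adjointable X] Psi).
Proof.
move=> pi_rep rho_inj pi_dense.
have pi_inj := hmod_representation_inj pi_rep rho_inj.
pose Phi := induced_op pi_rep pi_dense.
have Phi_hom : star_hom Phi := induced_star_hom pi_rep pi_dense.
have Phi_inj : injective Phi := induced_inj pi_inj.
split.
  exists Phi; split; last exact: induced_theta.
  rewrite -(induced_compacts pi_rep pi_dense pi_inj) -/Phi.
  exact: star_iso_image (compacts_star_subalgebra X).
move=> B tau.
have BE : B = Phi @` [set: adjointable X] := range_induced _ _ rho_inj.
split=> [b Bb _ [x _ <-]|]; first by case: (Bb x).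
exists (pinv [set: adjointable X] Phi).
have PhiK T : pinv [set: adjointable X] Phi (Phi T) = T.
  by apply: pinvKV; rewrite ?inE // => S S' _ _; exact: Phi_inj.
split=> [b|]; last by rewrite BE; exact: star_iso_inverse.
rewrite BE => -[T _ <-]; rewrite PhiK; apply/funext => x /=.
rewrite /tau inducedP pinvKV ?inE // => y y' _ _; exact: pi_inj.
Qed.
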